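(* Let $1<p<\infty$, let $\Omega\subset\mathbb{R}^n$ be a bounded domain, and let $\mu$, $Q$, $v$ be as in the context. Let $\rho$ be a quasimetric on $\Omega$ satisfying the standing conditions of the context and such that $(\Omega,\rho)$ is locally geometrically doubling. Suppose that (1) $(\Omega,\rho)$ supports a local Poincar\'e property of order $p$, and (2) $(\Omega,\rho)$ supports a local Sobolev property of order $p$ and gain $\sigma$ for some $\sigma>1$. Then for every $E\Subset\Omega$ and every $q\in[1,p\sigma)$, the space $QH^{1,p}(v,\mu;\Omega)$ is compactly embedded in $L^q_v(\mu;E)$ through the projection $\pi((u,\nabla u))=u|_E$; that is, $\pi$ maps $QH^{1,p}(v,\mu;\Omega)$ into $L^q_v(\mu;E)$, and for every bounded sequence in $QH^{1,p}(v,\mu;\Omega)$ the image sequence under $\pi$ has a subsequence converging in $L^q_v(\mu;E)$.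
   Context: Setting. $\Omega\subset\mathbb{R}^n$ is a bounded, open, connected set; $\mu$ is a regular measure on $\Omega$, absolutely continuous with respect to Lebesgue measure. $Q$ is a $\mu$-measurable function on $\Omega$ with values in the non-negative definite self-adjoint (real symmetric) $n\times n$ matrices, and $\sqrt{Q(x)}$ is the non-negative definite square root. Put $v_0(x)=\|Q(x)\|_{\mathrm{op}}^{p/2}$, where $\|Q(x)\|_{\mathrm{op}}=\sup_{|\xi|=1}|Q(x)\xi|$. It is assumed that $\sqrt Q\in L^p(\mu;\Omega)$. $v$ is a weight on $\Omega$ (a nonnegative function locally integrable with respect to $\mu$) for which there is $c_2>0$ with $v_0(x)\le c_2v(x)$ for $x\in\Omega$. Write $v(B)=\int_B v\,d\mu$, and let $L^q_v(\mu;E)$ be the space with norm $\|f\|_{L^q_v(\mu;E)}=(\int_E|f|^qv\,d\mu)^{1/q}$. $E\Subset\Omega$ means that the closure of $E$ is a compact subset of $\Omega$ (sets $E$ are measurable). Sobolev space. For a locally Lipschitz function $f$ and a measurable set $A\subset\Omega$ let $$\|(f,\nabla f)\|_{QH^{1,p}(v,\mu;A)}=\Big(\int_A|f|^pv\,d\mu\Big)^{1/p}+\Big(\int_A|\sqrt Q\,\nabla f|^p\,d\mu\Big)^{1/p}.$$ $Lip_Q(\Omega)$ is the set of locally Lipschitz $f$ on $\Omega$ for which this norm with $A=\Omega$ is finite. $\mathcal L^p_Q(\mu;\Omega)$ is the space of $\mu$-measurable vector fields $\vec k$ with $\|\vec k\|_{\mathcal L^p_Q(\mu;\Omega)}=(\int_\Omega|\sqrt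 Q\,\vec k|^pd\mu)^{1/p}<\infty$ (modulo fields of zero norm). $QH^{1,p}(v,\mu;\Omega)$ is the completion of $Lip_Q(\Omega)$ with respect to $\|\cdot\|_{QH^{1,p}(v,\mu;\Omega)}$, identified with the closure of $\{(f,\nabla f):f\in Lip_Q(\Omega)\}$ in $L^p_v(\mu;\Omega)\times\mathcal L^p_Q(\mu;\Omega)$; its elements are written as pairs $(u,\nabla u)$, where the second component $\nabla u$ denotes the $\mathcal L^p_Q$-limit of gradients of an approximating sequence. Quasimetric. $\rho$ is a quasimetric on $\Omega$: for some $\kappa\ge1$ and all $x,y,z\in\Omega$, $\rho(x,y)\ge0$ with equality only if $x=y$, $\rho(x,y)=\rho(y,x)$, and $\rho(x,y)\le\kappa(\rho(x,z)+\rho(z,y))$. $B(x,r)=\{y\in\Omega:\rho(x,y)<r\}$. Standing conditions: all $\rho$-balls are open (in the Euclidean topology), and for every $x\in\Omega$ there is $\delta(x)>0$ with $\overline{B(x,r)}\subset\Omega$ for $0<r<\delta(x)$. Locally geometrically doubling: there is a function $C:(0,\infty)\to(0,\infty)$ such that for every compact $K\subset\Omega$ there is $\delta>0$ such that whenever $0<s\le r<\delta$ and $x\in K$, the ball $B(x,r)$ contains at most $C(r/s)$ centers of disjoint $\rho$-balls of radius $s$ ($C$ is independent of $K$). Local Poincar\'e property of order $p$: there is $c_0\ge1$ such that for every compact $K\subset\Omega$ and $\epsilon>0$ there is $\delta_1>0$ such that for $0<r<\delta_1$ and $x\in K$, $$\|f-f_{B(x,r)}\|_{L^p_v(\mu;B(x,r))}\le\epsilon\,\|(f,\nabla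 f)\|_{QH^{1,p}(v,\mu;B(x,c_0r))}$$ for every locally Lipschitz $f$ on $\Omega$, where $f_B=\frac1{v(B)}\int_Bfv\,d\mu$. Local Sobolev property of order $p$ and gain $\sigma$ ($\sigma\ge1$): for every compact $K\subset\Omega$ there is $\delta_2>0$ such that for every ball $B=B(x,r)$ with $x\in K$ and $0<r<\delta_2$ there is a constant $C(B)$ with $$\Big(\int_B|f|^{p\sigma}v\,d\mu\Big)^{1/(p\sigma)}\le C(B)\,\|(f,\nabla f)\|_{QH^{1,p}(v,\mu;\Omega)}$$ for every $f\in Lip_0(B)$, i.e. every locally Lipschitz function with compact support in $B$ (extended by zero to $\Omega$). *)

(* Defs.v *)
From HB Require Import structures.
From mathcomp Require Import all_boot all_order all_algebra.
From mathcomp Require Import all_classical all_reals all_analysis.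

Set Implicit Arguments.
Unset Strict Implicit.
Unset Printing Implicit Defensive.

Import Order.TTheory GRing.Theory Num.Theory.
Import numFieldNormedType.Exports.

Local Open Scope classical_set_scope.
Local Open Scope ring_scope.

(* Points of R^n are row vectors 'rV[R]_n, gradients and vector fields take
   values in column vectors.  The library's norm on matrices is the sup-norm;
   it induces the Euclidean topology, bounded sets and Lipschitz functions.
   Functions on a set Omega are total functions whose values outside Omega are
   irrelevant. *)

Section LinearAlgebra.
Context {R : realType} {n : nat}.
Implicit Types (A S : 'M[R]_n) (xi : 'cV[R]_n).

Definition enorm xi : R := Num.sqrt (\sum_i xi i 0 ^+ 2).

Definition opnorm A : R := sup [set enorm (A *m xi) | xi in [set xi | enorm xi = 1]].

Definition psdmx A : Prop :=
  A^T = A /\ forall xi, 0 <= (xi^T *m A *m xi) 0 0.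

(* the unique positive semidefinite square root of A, when psdmx A *)
Definition sqrtmx A : 'M[R]_n := xget 0 [set S | psdmx S /\ S *m S = A].

End LinearAlgebra.

(* On Borel sets this is Lebesgue measure on R^n, i.e. the n-fold product
   lebesgue_measure \x ... \x lebesgue_measure, written out by sections. *)
Fixpoint lebesgue_rV {R : realType} (n : nat) : set 'rV[R]_n -> \bar R :=
  match n with
  | 0 => fun A => (\1_A (0 : 'rV[R]_0))%:E
  | m.+1 => fun A => (\int[lebesgue_measure]_(t in [set: R])
      lebesgue_rV [set y : 'rV[R]_m | A (row_mx (t%:M : 'rV[R]_1) y)])%E
  end.

(* The sigma-algebra of mu-measurable sets is <<s G >>, the measurable sets of
   g_sigma_algebraType G.  With G arbitrary it is any sigma-algebra: Borel sets,
   their mu-completion, Lebesgue sets, and so on. *)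
Definition measurable_mx_fun {R : realType} {n m k : nat}
    (G : set (set 'rV[R]_n)) (A : set 'rV[R]_n) (F : 'rV[R]_n -> 'M[R]_(m, k)) :=
  forall i j, measurable_fun (A : set (g_sigma_algebraType G))
                ((fun x => F x i j) : g_sigma_algebraType G -> R).

(* A measure on Omega is a measure on R^n of which only the values on subsets
   of Omega matter. *)
Section Measures.
Context {R : realType} {n : nat}.
Let E := 'rV[R]_n.
Context {G : set (set E)}.
Let T := g_sigma_algebraType G.
Variables (Omega : set E) (mu : {measure set T -> \bar R}).

Definition abs_cont_lebesgue : Prop :=
  forall A : set E, <<s @open E >> A -> A `<=` Omega ->
    lebesgue_rV A = 0%E -> mu A = 0%E.

(* outer regularity by open sets and inner regularity by compact sets *)
Definition regular_on : Prop := forall A : set T, measurable A -> A `<=` Omega ->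
  mu A = ereal_inf [set mu U | U in
           [set U : set E | [/\ open U, A `<=` U & U `<=` Omega]]] /\
  mu A = ereal_sup [set mu K | K in [set K : set E | compact K /\ K `<=` A]].

Definition locally_integrable_on (f : E -> R) : Prop :=
  measurable_fun (Omega : set T) (f : T -> R) /\
  forall K : set E, compact K -> K `<=` Omega ->
    (\int[mu]_(x in K) `|f x|%:E < +oo)%E.

End Measures.

Section LocallyLipschitz.
Context {R : realType} {n : nat}.
Let E := 'rV[R]_n.
Implicit Types (A B : set E) (f : E -> R).

Definition loc_lipschitz A f : Prop := forall x, A x ->
  exists2 U : set E, nbhs x U & [lipschitz f y | y in A `&` U].

(* The partial derivatives; for locally Lipschitz f on an open set they exist
   Lebesgue-almost everywhere, and elsewhere 'D is an unspecified value. *)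
Definition grad f (x : E) : 'cV[R]_n := \col_i 'D_(delta_mx 0 i : E) f x.

(* f vanishes off B, so that f is its own extension by zero *)
Definition Lip0 B f : Prop :=
  let supp := closure [set x | f x != 0] in
  [/\ loc_lipschitz B f, compact supp & supp `<=` B].

(* A is relatively compact in Omega *)
Definition relcompact_in A (Omega : set E) : Prop :=
  compact (closure A) /\ closure A `<=` Omega.

End LocallyLipschitz.

Section Sobolev.
Context {R : realType} {n : nat}.
Let E := 'rV[R]_n.
Context {G : set (set E)}.
Let T := g_sigma_algebraType G.
Variables (Omega : set E) (mu : {measure set T -> \bar R}).
Variables (Q : E -> 'M[R]_n) (v : E -> R) (p : R).
Implicit Types (A B : set E) (f u : E -> R) (k : E -> 'cV[R]_n).

Definition wLnorm (q : R) A f : \bar R :=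
  ((\int[mu]_(x in A) (`|f x| `^ q * v x)%:E) `^ q^-1)%E.

Definition in_Lqv (q : R) A f : Prop :=
  measurable_fun (A : set T) (f : T -> R) /\ (wLnorm q A f < +oo)%E.

Definition LQnorm A k : \bar R :=
  ((\int[mu]_(x in A) (enorm (sqrtmx (Q x) *m k x) `^ p)%:E) `^ p^-1)%E.

Definition QHnorm A f k : \bar R := (wLnorm p A f + LQnorm A k)%E.

Definition LipQ f : Prop :=
  loc_lipschitz Omega f /\ (QHnorm Omega f (grad f) < +oo)%E.

(* Representatives of the elements of QH^{1,p}(v,mu;Omega): the closure of
   {(f, grad f) | f in LipQ} in the product of L^p_v and L^p_Q. *)
Definition QHspace u k : Prop :=
  [/\ in_Lqv p Omega u,
      measurable_mx_fun G Omega k /\ (LQnorm Omega k < +oo)%E &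
      exists f : nat -> E -> R, (forall j, LipQ (f j)) /\
        (fun j => QHnorm Omega (f j \- u) (grad (f j) \- k)) @ \oo --> 0%E].

End Sobolev.

Section Quasimetric.
Context {R : realType} {n : nat}.
Let E := 'rV[R]_n.
Variables (Omega : set E) (rho : E -> E -> R).

Definition quasimetric : Prop := exists2 kappa : R, 1 <= kappa &
  forall x y z, Omega x -> Omega y -> Omega z ->
    [/\ 0 <= rho x y, rho x y = 0 <-> x = y, rho x y = rho y x &
        rho x y <= kappa * (rho x z + rho z y)].

Definition qball (x : E) (r : R) : set E := [set y | Omega y /\ rho x y < r].

Definition qball_conditions : Prop :=
  (forall x r, Omega x -> open (qball x r)) /\
  (forall x, Omega x -> exists2 delta : R, 0 < delta &
     forall r : R, 0 < r < delta -> closure (qball x r) `<=` Omega).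

Definition loc_geom_doubling : Prop :=
  exists C : R -> R, (forall t : R, 0 < t -> 0 < C t) /\
  forall K : set E, compact K -> K `<=` Omega -> exists2 delta : R, 0 < delta &
  forall (s r : R) (x : E), 0 < s -> s <= r -> r < delta -> K x ->
  forall (m : nat) (c : 'I_m -> E),
    (forall i, qball x r (c i)) ->
    trivIset [set: 'I_m] (fun i => qball (c i) s) ->
    m%:R <= C (r / s).

Context {G : set (set E)}.
Let T := g_sigma_algebraType G.
Variables (mu : {measure set T -> \bar R}).
Variables (Q : E -> 'M[R]_n) (v : E -> R) (p : R).

(* 0 if v(B) = 0, by the convention 0^-1 = 0 *)
Definition wmean (B : set E) (f : E -> R) : R :=
  (\int[mu]_(x in B) (f x * v x)) / (\int[mu]_(x in B) v x).

Definition loc_poincare : Prop :=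
  exists2 c0 : R, 1 <= c0 &
  forall (K : set E) (eps : R), compact K -> K `<=` Omega -> 0 < eps ->
  exists2 delta1 : R, 0 < delta1 &
  forall (r : R) (x : E) (f : E -> R), 0 < r < delta1 -> K x -> loc_lipschitz Omega f ->
    let B := qball x r in
    (wLnorm mu v p B (fun y => f y - wmean B f)%R <=
     eps%:E * QHnorm mu Q v p (qball x (c0 * r)) f (grad f))%E.

Definition loc_sobolev (sigma : R) : Prop :=
  forall K : set E, compact K -> K `<=` Omega ->
  exists2 delta2 : R, 0 < delta2 &
  forall (r : R) (x : E), 0 < r < delta2 -> K x -> exists2 C : R, 0 < C &
  forall f : E -> R, Lip0 (qball x r) f ->
    (wLnorm mu v (p * sigma) (qball x r) f <=
     C%:E * QHnorm mu Q v p Omega f (grad f))%E.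

End Quasimetric.

(* Main.v *)
Require Import Defs.
From mathcomp Require Import all_boot all_order all_algebra.
From mathcomp Require Import all_classical all_reals all_analysis.
From mathcomp Require Import measurable_realfun ring lra.
Import Order.TTheory GRing.Theory Num.Theory.
Import numFieldNormedType.Exports.
Local Open Scope classical_set_scope.
Local Open Scope ring_scope.

(** The embedding is compact for the reason behind Rellich's theorem: the
    Poincare inequality on small balls makes a bounded family precompact in
    L^p_v, the Sobolev inequality bounds it in L^(p sigma)_v, and interpolation
    between the two exponents gives compactness for every q below p sigma.

    All estimates are written for p-th powers of norms, wpow for the functions
    and gpow for the gradients.  Powers are additive over the domain, and their
    triangle inequality, which costs a factor 2^p, suffices throughout.

    Higher integrability (sobolev_on_compact, QH_higher_integrability).  Near
    each point of the closure of E a cutoff eta supported in a rho-ball is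
    bounded below, and the local Sobolev inequality applies to f eta.  The
    energy of f eta is at most a multiple of that of f plus the integral of
    |f|^p opnorm(Q)^(p/2), which v dominates (cutoff_energy).  Finitely many
    such neighbourhoods cover E, and Fatou's lemma carries the bound from
    Lipschitz functions to the completion.

    Compactness in L^p_v (bounded_overlap_cover, poincare_ultrafilter_cauchy).
    The doubling condition covers the closure of E by balls of an arbitrarily
    small radius r whose dilates B(x, c0 r) overlap at most N times, with N
    independent of r.  Summing the Poincare inequalities, each f in a bounded
    family is L^p_v-close to its averages on these finitely many balls, and the
    averages are bounded numbers.  Along a free ultrafilter on the indices every
    such average is nearly constant, hence for each e some member A of the
    ultrafilter has all f_i, f_j with i, j in A within e of each other.
    Ultrafilters are closed under finite intersections, so that a subsequence
    with prescribed rate of convergence is extracted in one diagonal step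
    (ultrafilter_extraction).  The Poincare inequality is applied to every f_i
    by itself, because the gradient of f_i - f_j is the difference of the
    gradients only where both exist.

    Conclusion (wpow_complete).  A sequence that is Cauchy in L^p_v at a
    summable rate converges almost everywhere on {v > 0}.  By Fatou's lemma the
    limit inherits the Cauchy estimate and the bound in L^(p sigma)_v, and
    t^q <= e (1 + t^(p sigma)) + C t^p turns both into convergence in L^q_v.

    Gradients of locally Lipschitz functions enter pointwise.  The integral of a
    nonnegative function is the supremum over its measurable minorants, so the
    inequalities used for gpow hold for gradients as plain functions.  Where a
    partial derivative does not exist its value is 0, and there the product rule
    with eta still holds up to an error of size |f| |grad eta|
    (derive_mul_default). *)

Set Implicit Arguments.
Unset Strict Implicit.
Unset Printing Implicit Defensive.

(** * Powers of real and extended real numbers *)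

Section PowR.
Context {R : realType}.
Implicit Types a b c t p q r : R.

Lemma ler_powR2r q a b : 0 <= q -> 0 <= a -> a <= b -> a `^ q <= b `^ q.
Proof.
by move=> q0 a0 ab; apply: ge0_ler_powR; rewrite ?nnegrE// (le_trans a0).
Qed.

Lemma powR_le1 q a : 0 <= q -> 0 <= a -> a <= 1 -> a `^ q <= 1.
Proof. by move=> q0 a0 a1; have := ler_powR2r q0 a0 a1; rewrite powR1. Qed.

Lemma powRD_le q a b : 0 < q -> 0 <= a -> 0 <= b ->
  (a + b) `^ q <= 2 `^ q * (a `^ q + b `^ q).
Proof.
move=> q0 a0 b0; wlog ab : a b a0 b0 / a <= b.
  move=> H; have [/H|/ltW /H] := leP a b; first exact.
  by rewrite addrC [X in _ * X]addrC; exact.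
apply: (@le_trans _ _ ((2 * b) `^ q)).
  by apply: ler_powR2r; [exact: ltW|exact: addr_ge0|lra].
by rewrite powRM// ler_wpM2l// ?powR_ge0// lerDr powR_ge0.
Qed.

Lemma powR_norm_le q a b c : 0 < q -> `|a| <= `|b| + `|c| ->
  `|a| `^ q <= 2 `^ q * (`|b| `^ q + `|c| `^ q).
Proof.
move=> q0 abc; apply: le_trans (powRD_le q0 (normr_ge0 b) (normr_ge0 c)).
by apply: ler_powR2r => //; exact: ltW.
Qed.

Lemma ler_sum3 (x a b c : R) : 0 <= a -> 0 <= b -> 0 <= c ->
  [\/ x <= a, x <= b | x <= c] -> x <= a + b + c.
Proof. by move=> a0 b0 c0 []; lra. Qed.

(** Large values are absorbed by the higher power, small values by the
    constant, and on the compact range in between all powers are comparable. *)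
Lemma powR_interpolation p q r e : 0 < p -> 0 < q < r -> 0 < e ->
  exists2 C, 0 < C & forall t, 0 <= t -> t `^ q <= e * (1 + t `^ r) + C * t `^ p.
Proof.
move=> p0 /andP[q0 qr] e0.
(* beyond hi the term e t^r dominates t^q, below lo the constant e does *)
pose hi := e^-1 `^ (r - q)^-1; pose lo := e `^ q^-1.
have rq0 : 0 < r - q by rewrite subr_gt0.
have hi0 : 0 < hi by apply: powR_gt0; rewrite invr_gt0.
have lo0 : 0 < lo by exact: powR_gt0.
have hiE : hi `^ (r - q) = e^-1.
  by rewrite /hi -powRrM mulVf ?gt_eqF// powRr1// invr_ge0 ltW.
have loE : lo `^ q = e by rewrite /lo -powRrM mulVf ?gt_eqF// powRr1// ltW.
exists (hi `^ q / lo `^ p) => [|t t0]; first by rewrite divr_gt0// powR_gt0.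
rewrite mulrDr mulr1; have er0 : 0 <= e * t `^ r by rewrite mulr_ge0 ?powR_ge0// ltW.
have Cp0 : 0 <= hi `^ q / lo `^ p * t `^ p by rewrite mulr_ge0 ?divr_ge0 ?powR_ge0.
apply: ler_sum3 => //; first exact: ltW.
have [hit|thi] := leP hi t.
  apply: Or32.
  rewrite mulrC -ler_pdivrMr// -hiE (_ : t `^ r = t `^ q * t `^ (r - q)); last first.
    by rewrite -powRD ?subrKC// (gt_eqF (lt_trans q0 qr)).
  by rewrite ler_wpM2l ?powR_ge0//; apply: ler_powR2r => //; exact: ltW.
have [tlo|lot] := leP t lo.
  by apply: Or31; rewrite -loE; apply: ler_powR2r => //; exact: ltW.
apply: Or33.
apply: (@le_trans _ _ (hi `^ q)); first by apply: ler_powR2r => //; exact: ltW.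
rewrite -mulrA ler_peMr ?powR_ge0// mulrC ler_pdivlMr ?powR_gt0// mul1r.
by apply: ler_powR2r => //; exact: ltW.
Qed.

End PowR.

Lemma small_powR {R : realType} (p K e : R) : 0 < p -> 0 <= K -> 0 < e ->
  exists2 t : R, 0 < t & K * t `^ p <= e.
Proof.
move=> p0 K0 e0; have K1 : 0 < K + 1 by rewrite ltr_wpDl.
exists ((e / (K + 1)) `^ p^-1); first by rewrite powR_gt0 ?divr_gt0.
rewrite -powRrM mulVf ?gt_eqF// powRr1 ?divr_ge0 ?(ltW e0) ?(ltW K1)//.
by rewrite mulrCA ger_pMr// ler_pdivrMr// mul1r lerDl.
Qed.

Lemma poweR_inv_le {R : realType} (X : \bar R) (p M : R) : (0 <= X)%E -> 0 < p -> 0 <= M ->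
  ((X `^ p^-1)%E <= M%:E)%E <-> (X <= (M `^ p)%:E)%E.
Proof.
move=> X0 p0 M0; case: X X0 => [x||]//; last first.
  by rewrite poweRyr ?invr_eq0 ?gt_eqF.
rewrite lee_fin => x0; rewrite poweR_EFin !lee_fin.
have pK (t : R) : 0 <= t -> (t `^ p^-1) `^ p = t.
  by move=> t0; rewrite -powRrM mulVf ?gt_eqF// powRr1.
have pK' (t : R) : 0 <= t -> (t `^ p) `^ p^-1 = t.
  by move=> t0; rewrite -powRrM mulfV ?gt_eqF// powRr1.
split=> H.
  by rewrite -[leLHS]pK//; apply: ler_powR2r; rewrite ?powR_ge0// ltW.
by rewrite -[leRHS]pK'//; apply: ler_powR2r; rewrite ?invr_ge0// ltW.
Qed.

Lemma sume_linear3_le {R : realType} {I : Type} (s : seq I) (a b c : I -> \bar R)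
    (x y z A B C : R) : 0 <= x -> 0 <= y -> 0 <= z ->
  (forall i, 0 <= a i)%E -> (forall i, 0 <= b i)%E -> (forall i, 0 <= c i)%E ->
  (\sum_(i <- s) a i <= A%:E)%E -> (\sum_(i <- s) b i <= B%:E)%E ->
  (\sum_(i <- s) c i <= C%:E)%E ->
  (\sum_(i <- s) (x%:E * a i + (y%:E * b i + z%:E * c i)) <=
   (x * A + (y * B + z * C))%:E)%E.
Proof.
move=> x0 y0 z0 a0 b0 c0 HA HB HC.
rewrite big_split/= big_split/= -(ge0_sume_distrr s (P := xpredT) x%:E)//.
rewrite -(ge0_sume_distrr s (P := xpredT) y%:E)//.
rewrite -(ge0_sume_distrr s (P := xpredT) z%:E)//.
rewrite (EFinD (x * A)) (EFinD (y * B)) (EFinM x) (EFinM y) (EFinM z).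
by apply: leeD; [|apply: leeD]; apply: lee_wpmul2l; rewrite ?lee_fin.
Qed.

(** The shape taken by two consecutive uses of the triangle inequality for
    p-th powers, with t = 2^p. *)
Lemma le_nested3 {R : realType} (a b d X Y : \bar R) (t c : R) : 0 <= t ->
  (X <= t%:E * (a + Y))%E -> (Y <= t%:E * (b + d))%E ->
  (a <= c%:E)%E -> (b <= c%:E)%E -> (d <= c%:E)%E ->
  (X <= (t * (c + t * (c + c)))%:E)%E.
Proof.
move=> t0 HX HY Ha Hb Hd; have te : (0 <= t%:E)%E by rewrite lee_fin.
apply: le_trans HX _; rewrite EFinM (EFinD c); apply: lee_wpmul2l => //.
apply: leeD => //; apply: le_trans HY _; rewrite EFinM (EFinD c).
by apply: lee_wpmul2l => //; exact: leeD.
Qed.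

(** * Integrals of nonnegative functions, measurable or not *)

Section LowerIntegral.
Context d (T : measurableType d) (R : realType).
Variable mu : {measure set T -> \bar R}.
Import HBNNSimple.

Lemma ge0_le_lower_integral (D : set T) (f g : T -> \bar R) :
  (forall x, D x -> (0 <= f x)%E) -> (forall x, D x -> (f x <= g x)%E) ->
  (\int[mu]_(x in D) f x <= \int[mu]_(x in D) g x)%E.
Proof.
move=> f0 fg.
have g0 x : D x -> (0 <= g x)%E by move=> Dx; exact: le_trans (f0 _ Dx) (fg _ Dx).
rewrite !ge0_integralE//; apply: ge_ereal_sup => _ [h hf <-].
apply: ereal_sup_ubound; exists h => // x.
apply: le_trans (hf x) _.
rewrite !patchE; case: ifPn => // /set_mem; exact: fg.
Qed.

(** The integral of a nonnegative function is by definition a supremum over the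
    simple functions below it, so an upper bound only has to be checked on
    measurable minorants. *)
Lemma ge0_lower_integral_le (D : set T) (g : T -> R) (c : \bar R) :
  measurable D -> (forall x, D x -> 0 <= g x) ->
  (forall h : T -> R, measurable_fun setT h -> (forall x, 0 <= h x) ->
     (forall x, D x -> h x <= g x) -> (forall x, ~ D x -> h x = 0) ->
     (\int[mu]_x (h x)%:E <= c)%E) ->
  (\int[mu]_(x in D) (g x)%:E <= c)%E.
Proof.
move=> mD g0 H; rewrite ge0_integralE; last by move=> x Dx; rewrite lee_fin g0.
apply: ge_ereal_sup => _ [h hg <-]; rewrite -integralT_nnsfun.
apply: H => //.
- by move=> x Dx; have := hg x; rewrite patchE mem_set// lee_fin.
- move=> x Dx; have := hg x; rewrite patchE memNset// lee_fin => h0.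
  by apply/eqP; rewrite eq_le h0 fun_ge0.
Qed.

Lemma ge0_subset_lower_integral (A B : set T) (g : T -> \bar R) :
  A `<=` B -> (forall x, B x -> (0 <= g x)%E) ->
  (\int[mu]_(x in A) g x <= \int[mu]_(x in B) g x)%E.
Proof.
move=> AB g0; rewrite [leLHS]integral_mkcond [leRHS]integral_mkcond.
apply: ge0_le_lower_integral => x _; rewrite !patchE.
  by case: ifPn => // /set_mem /AB /g0.
case: ifPn => [/set_mem Ax|_]; first by rewrite mem_set//; exact: AB.
by case: ifPn => // /set_mem /g0.
Qed.

(** Integrals of arbitrary nonnegative functions are not subadditive, but they
    are when one of the summands, here h, is measurable: a measurable minorant s
    of f yields the measurable minorant max(0, (s - h) / c) of g. *)
Lemma lower_integral_le_lin (D : set T) (f g h : T -> R) (c : R) :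
  measurable D -> 0 < c ->
  (forall x, D x -> 0 <= f x) -> (forall x, D x -> 0 <= g x) ->
  (forall x, D x -> 0 <= h x) -> measurable_fun D h ->
  (forall x, D x -> f x <= c * g x + h x) ->
  (\int[mu]_(x in D) (f x)%:E <=
   c%:E * \int[mu]_(x in D) (g x)%:E + \int[mu]_(x in D) (h x)%:E)%E.
Proof.
move=> mD c0 f0 g0 h0 mh fgh; apply: ge0_lower_integral_le => // s ms s0 sf sD.
have {sD} -> : (\int[mu]_x (s x)%:E = \int[mu]_(x in D) (s x)%:E)%E.
  rewrite [RHS]integral_mkcond; apply: eq_integral => x _; rewrite patchE.
  by case: ifPn => // /negP xD; rewrite sD// => Dx; apply: xD; exact: mem_set.
have {}ms : measurable_fun D s by apply: measurable_funS ms.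
pose t x := Num.max 0 (c^-1 * (s x - h x)).
have mt : measurable_fun D t.
  apply: measurable_maxr; first exact: measurable_cst.
  by apply: measurable_funM; [exact: measurable_cst|exact: measurable_funB].
have t0 x : 0 <= t x by rewrite le_max lexx.
have tg x : D x -> t x <= g x.
  move=> Dx; rewrite ge_max g0//= ler_pdivrMl// lerBlDr.
  exact: le_trans (sf _ Dx) (fgh _ Dx).
have st x : s x <= c * t x + h x.
  rewrite -lerBlDr -ler_pdivrMl//; by rewrite le_max lexx orbT.
apply: (@le_trans _ _ (\int[mu]_(x in D) (c%:E * (t x)%:E + (h x)%:E))%E).
  apply: ge0_le_lower_integral => x Dx; first by rewrite lee_fin.
  by rewrite -EFinM -EFinD lee_fin.
rewrite ge0_integralD//; last 3 first.
- by move=> x Dx; rewrite -EFinM lee_fin mulr_ge0// ltW.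
- under eq_fun do rewrite -EFinM.
  by apply/measurable_EFinP; apply: measurable_funM => //; exact: measurable_cst.
- exact/measurable_EFinP.
rewrite leeD2r// ge0_integralZl_EFin//; last 3 first.
- by move=> x _; rewrite lee_fin.
- exact/measurable_EFinP.
- exact: ltW.
rewrite lee_pmul2l ?lte_fin//; apply: ge0_le_lower_integral => x Dx.
  by rewrite lee_fin.
by rewrite lee_fin tg.
Qed.

(** Sums of minorants are minorants of sums, so these integrals are
    superadditive.  The induction on s accumulates in h the minorants already
    chosen on the first sets. *)
Lemma sum_lower_integral_overlap (I : eqType) (s : seq I) (A : I -> set T)
    (D : set T) (g : T -> R) (N : R) :
  measurable D -> 0 < N -> (forall i, i \in s -> measurable (A i)) ->
  (forall i, i \in s -> A i `<=` D) -> (forall x, D x -> 0 <= g x) ->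
  (forall x, D x -> \sum_(i <- s) (\1_(A i) x : R) <= N) ->
  (\sum_(i <- s) \int[mu]_(x in A i) (g x)%:E <=
   N%:E * \int[mu]_(x in D) (g x)%:E)%E.
Proof.
move=> mD N0 mA AD g0 sN.
suff H : forall h : T -> R, measurable_fun setT h -> (forall x, 0 <= h x) ->
    (forall x, ~ D x -> h x = 0) ->
    (forall x, D x -> h x + \sum_(i <- s) (\1_(A i) x : R) * g x <= N * g x) ->
  (\int[mu]_x (h x)%:E + \sum_(i <- s) \int[mu]_(x in A i) (g x)%:E <=
   N%:E * \int[mu]_(x in D) (g x)%:E)%E.
  have := H (cst 0); rewrite integral0 add0e; apply => //.
  by move=> x Dx; rewrite add0r -mulr_suml ler_wpM2r// ?g0// sN.
elim: s {sN} mA AD => [|i s IH] mA AD h mh h0 hD hg.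
  rewrite big_nil adde0.
  have -> : (\int[mu]_x (h x)%:E = \int[mu]_(x in D) (h x)%:E)%E.
    rewrite [RHS]integral_mkcond; apply: eq_integral => x _; rewrite patchE.
    by case: ifPn => // /negP xD; rewrite hD// => Dx; apply: xD; exact: mem_set.
  rewrite -[leRHS]adde0 -(integral0 mu D).
  apply: (@lower_integral_le_lin D h g (cst 0) N) => //.
  by move=> x Dx; have := hg _ Dx; rewrite big_nil /= !addr0.
have mAi : measurable (A i) by apply: mA; exact: mem_head.
have AiD : A i `<=` D by apply: AD; exact: mem_head.
have sub j : j \in s -> j \in i :: s by rewrite inE orbC => ->.
have {}IH := IH (fun j js => mA j (sub j js)) (fun j js => AD j (sub j js)).
set C := (_ * _)%E; have [->|Cfin] := eqVneq C +oo%E; first exact: leey.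
rewrite big_cons addeCA.
set y := (_ + \sum_(_ <- _) _)%E.
have Hy : (y <= C)%E.
  apply: IH => // x Dx; apply: le_trans (hg _ Dx).
  by rewrite big_cons lerD2l lerDr mulr_ge0// g0.
have y0 : (0 <= y)%E.
  apply: adde_ge0; first by apply: integral_ge0 => x _; rewrite lee_fin.
  rewrite big_seq; apply: sume_ge0 => j js; apply: integral_ge0 => x Ax.
  by rewrite lee_fin g0//; exact: AD (sub j js) _ Ax.
have C0 : (0 <= C)%E by exact: le_trans Hy.
have Cf : C \is a fin_num by rewrite ge0_fin_numE// ltey.
have yf : y \is a fin_num.
  by rewrite ge0_fin_numE//; apply: le_lt_trans Hy _; rewrite ltey.
rewrite -leeBrDr//.
apply: ge0_lower_integral_le => //; first by move=> x /AiD; exact: g0.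
move=> k mk k0 kg kA; rewrite leeBrDr// addeA -ge0_integralD//; last 4 first.
- by move=> x _; rewrite lee_fin.
- exact/measurable_EFinP.
- by move=> x _; rewrite lee_fin.
- exact/measurable_EFinP.
under eq_integral do rewrite -EFinD.
apply: IH => [|x|x xD|x Dx].
- exact: measurable_funD.
- exact: addr_ge0.
- by rewrite hD// kA ?addr0// => /AiD.
- have := hg _ Dx; rewrite big_cons; apply: le_trans.
  rewrite (addrC (k x)) -addrA lerD2l lerD2r.
  rewrite indicE; case: (boolP (x \in A i)) => [/set_mem /kg|/negP Ax].
    by rewrite mul1r.
  by rewrite kA ?mul0r// => /mem_set.
Qed.

End LowerIntegral.

(** * Integrals of weighted powers *)

Section WeightedPower.
Context d (T : measurableType d) (R : realType).
Variable mu : {measure set T -> \bar R}.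
Implicit Types (A D : set T) (f g h v : T -> R) (p q r : R).

(** The q-th power of the norm of L^q_v, chosen because it is additive over the
    domain. *)
Definition wpow v q A f : \bar R := (\int[mu]_(x in A) (`|f x| `^ q * v x)%:E)%E.

Lemma measurable_wpow v q D f : measurable_fun D f -> measurable_fun D v ->
  measurable_fun D (fun x => `|f x| `^ q * v x).
Proof.
move=> mf mv; apply: measurable_funM => //.
apply: (measurableT_comp (measurable_powR q)).
exact: measurableT_comp.
Qed.

Lemma wpow_ge0 v q A f : (forall x, A x -> 0 <= v x) -> (0 <= wpow v q A f)%E.
Proof.
by move=> v0; apply: integral_ge0 => x Ax; rewrite lee_fin mulr_ge0 ?powR_ge0 ?v0.
Qed.

Lemma wpow_subset v q A D f : A `<=` D -> (forall x, D x -> 0 <= v x) ->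
  (wpow v q A f <= wpow v q D f)%E.
Proof.
move=> AD v0; apply: ge0_subset_lower_integral => // x Dx.
by rewrite lee_fin mulr_ge0 ?powR_ge0 ?v0.
Qed.

Section OnDomain.
Variables (D : set T) (v : T -> R).
Hypotheses (mD : measurable D) (mv : measurable_fun D v).
Hypothesis v0 : forall x, D x -> 0 <= v x.
Local Notation wp q f := (wpow v q D f).

Let w0 q f x : D x -> (0 <= (`|f x| `^ q * v x)%:E)%E.
Proof. by move=> Dx; rewrite lee_fin mulr_ge0 ?powR_ge0 ?v0. Qed.

Lemma le_wpow2 q f g h (a b : R) : 0 <= a -> 0 <= b ->
  measurable_fun D g -> measurable_fun D h ->
  (forall x, D x -> `|f x| `^ q * v x <=
     a * (`|g x| `^ q * v x) + b * (`|h x| `^ q * v x)) ->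
  (wp q f <= a%:E * wp q g + b%:E * wp q h)%E.
Proof.
move=> a0 b0 mg mh fgh.
have mg' := measurable_wpow q mg mv; have mh' := measurable_wpow q mh mv.
apply: (@le_trans _ _ (\int[mu]_(x in D)
  (a%:E * (`|g x| `^ q * v x)%:E + b%:E * (`|h x| `^ q * v x)%:E))%E).
  apply: ge0_le_lower_integral => x Dx; first exact: w0.
  by rewrite -!EFinM -EFinD lee_fin fgh.
rewrite ge0_integralD//.
- rewrite !ge0_integralZl_EFin//; first by move=> x; exact: w0.
  + exact/measurable_EFinP.
  + by move=> x; exact: w0.
  + exact/measurable_EFinP.
- by move=> x Dx; rewrite mule_ge0// w0.
- by under eq_fun do rewrite -EFinM; apply/measurable_EFinP; exact: measurable_funM.
- by move=> x Dx; rewrite mule_ge0// w0.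
- by under eq_fun do rewrite -EFinM; apply/measurable_EFinP; exact: measurable_funM.
Qed.

Lemma wpow_le_add q f g h : 0 < q ->
  measurable_fun D g -> measurable_fun D h ->
  (forall x, D x -> `|f x| <= `|g x| + `|h x|) ->
  (wp q f <= (2 `^ q)%:E * (wp q g + wp q h))%E.
Proof.
move=> q0 mg mh fgh; rewrite ge0_muleDr ?wpow_ge0//.
apply: le_wpow2 => //; rewrite ?powR_ge0// => x Dx.
rewrite !mulrA -mulrDl ler_wpM2r ?v0// -mulrDr; exact: powR_norm_le (fgh _ Dx).
Qed.

Lemma wpow_interpolation p q r e : 0 < p -> 0 < q < r -> 0 < e ->
  exists2 C, 0 < C & forall f, measurable_fun D f ->
   (wp q f <= e%:E * (\int[mu]_(x in D) (v x)%:E + wp r f) + C%:E * wp p f)%E.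
Proof.
move=> p0 qr e0; have [C C0 CP] := powR_interpolation p0 qr e0.
exists C => // f mf; have mr := measurable_wpow r mf mv.
have mp := measurable_wpow p mf mv.
have m1 : measurable_fun D (fun x => v x + `|f x| `^ r * v x).
  exact: measurable_funD.
have -> : (\int[mu]_(x in D) (v x)%:E + wp r f =
    \int[mu]_(x in D) (v x + `|f x| `^ r * v x)%:E)%E.
  under [RHS]eq_integral do rewrite EFinD.
  rewrite ge0_integralD//; first exact/measurable_EFinP.
    by move=> x; exact: w0.
  exact/measurable_EFinP.
have -> : (C%:E * wp p f = \int[mu]_(x in D) (C * (`|f x| `^ p * v x))%:E)%E.
  under [RHS]eq_integral do rewrite EFinM.
  rewrite ge0_integralZl_EFin//; first by move=> x; exact: w0.
    exact/measurable_EFinP.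
  exact: ltW.
apply: lower_integral_le_lin => //.
- by move=> x Dx; rewrite mulr_ge0 ?powR_ge0 ?v0.
- by move=> x Dx; apply: addr_ge0; rewrite ?mulr_ge0 ?powR_ge0 ?v0.
- by move=> x Dx; apply: mulr_ge0; rewrite ?mulr_ge0 ?powR_ge0 ?v0 ?ltW.
- exact: measurable_funM.
- move=> x Dx; have := CP _ (normr_ge0 (f x)).
  move=> /(ler_wpM2r (v0 Dx)) /le_trans; apply.
  by rewrite le_eqVlt; apply/orP; left; apply/eqP; ring.
Qed.

End OnDomain.
End WeightedPower.

Section Cover.
Context d (T : measurableType d) (R : realType).
Variable mu : {measure set T -> \bar R}.

Lemma wpow_cover (I : eqType) (s : seq I) (B : I -> set T) (v : T -> R) q
    (D K : set T) (f : T -> R) :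
  measurable D -> measurable_fun D v -> (forall x, D x -> 0 <= v x) ->
  measurable_fun D f -> (forall i, i \in s -> measurable (B i)) ->
  (forall i, i \in s -> B i `<=` D) ->
  (forall y, K y -> exists2 i, i \in s & B i y) ->
  (wpow mu v q K f <= \sum_(i <- s) wpow mu v q (B i) f)%E.
Proof.
move=> mD mv v0 mf mB BD KB.
pose F x := (`|f x| `^ q * v x)%:E.
have F0 x : D x -> (0 <= F x)%E.
  by move=> Dx; rewrite lee_fin mulr_ge0 ?powR_ge0 ?v0.
have mF : measurable_fun D F by apply/measurable_EFinP; exact: measurable_wpow.
have KD : K `<=` D by move=> y /KB[i /BD]; exact.
have -> : (\sum_(i <- s) wpow mu v q (B i) f =
    \sum_(i <- s) \int[mu]_(x in D) (F \_ (B i)) x)%E.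
  apply: eq_big_seq => i /BD BiD; rewrite -integral_mkcondr.
  by congr (integral _ _ _); apply/esym/setIidPr.
have {}KB y : K y -> has (fun i => y \in B i) s.
  by move=> /KB[i si Biy]; apply/hasP; exists i => //; exact: mem_set.
have KE : D `&` K = K by apply/setIidPr.
have -> : (wpow mu v q K f = \int[mu]_(x in D) (F \_ K) x)%E.
  by rewrite -integral_mkcondr KE.
have mG : forall i, measurable_fun D (fun x => if i \in s then (F \_ (B i)) x else 0%E).
  move=> i; have [si|_] := boolP (i \in s); last exact: measurable_cst.
  apply/(measurable_restrict F (mB i si) mD).
  exact: measurable_funS mF.
rewrite (eq_big_seq (fun i =>
    \int[mu]_(x in D) (if i \in s then (F \_ (B i)) x else 0)))%E; last first.
  by move=> i ->.
have G0 i x : D x -> (0 <= if i \in s then (F \_ (B i)) x else 0)%E.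
  by move=> Dx; case: ifP => // _; rewrite patchE; case: ifP => // _; exact: F0.
rewrite -(ge0_integral_sum mu mD mG)//.
apply: ge0_le_lower_integral => x Dx.
  by rewrite patchE; case: ifP => // _; exact: F0.
rewrite patchE; case: ifPn => [/set_mem /KB /hasP[i si Bi]|_]; last first.
  by apply: sume_ge0 => i _; exact: G0.
rewrite (big_rem i)//= si patchE Bi leeDl//.
by apply: sume_ge0 => j _; exact: G0.
Qed.

End Cover.

(** * Almost everywhere convergence and completeness *)

(** Half of 2^-j, so that the sum over all j is 1. *)
Definition dyad {R : realType} (j : nat) : R := 1 / (2 ^ j.+1)%:R.

Lemma dyad_gt0 {R : realType} j : 0 < dyad j :> R.
Proof. by rewrite /dyad divr_gt0// ltr0n expn_gt0. Qed.

Lemma dyad_le1 {R : realType} j : dyad j <= 1 :> R.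
Proof. by rewrite /dyad ler_pdivrMr ?ltr0n ?expn_gt0// mul1r ler1n expn_gt0. Qed.

Lemma dyad_rate {R : realType} (p : R) j : 0 < p ->
  0 < dyad j * dyad j `^ p /\ dyad j * dyad j `^ p <= dyad j :> R.
Proof.
move=> p0; have d0 := @dyad_gt0 R j; split; first by rewrite mulr_gt0 ?powR_gt0.
rewrite ler_piMr ?(ltW d0)//.
by have := ler_powR2r (ltW p0) (ltW d0) (dyad_le1 j); rewrite powR1.
Qed.

Lemma dyad_geometric {R : realType} (c : R) :
  (fun j => c * dyad j) = geometric (c / 2) (2^-1).
Proof.
apply/funext => j; rewrite /= /dyad expnS natrM invfM natrX exprVn; ring.
Qed.

Lemma half_lt1 {R : realType} : `|2^-1| < 1 :> R.
Proof. by rewrite ger0_norm ?invr_ge0// invf_lt1// ltr1n. Qed.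

Lemma cvg_series_dyad {R : realType} (c : R) : cvgn (series (fun j => c * dyad j)).
Proof. by rewrite dyad_geometric; exact: is_cvg_geometric_series half_lt1. Qed.

Lemma cvg_dyad0 {R : realType} (c : R) : (fun j => c * dyad j) @ \oo --> (0 : R).
Proof. by rewrite dyad_geometric; exact: cvg_geometric half_lt1. Qed.

Lemma cvg_of_dyadic_steps {R : realType} (w : nat -> R) (c : R) :
  (forall j, `|w j.+1 - w j| <= c * dyad j) -> cvgn w.
Proof.
move=> wc.
have H : cvgn (series (telescope w)).
  apply: normed_cvg.
  apply: (@series_le_cvg R (fun n => `|telescope w n|) (fun j => c * dyad j)) => //.
    by move=> n; exact: le_trans (wc n).
  exact: cvg_series_dyad.
have -> : w = (fun n => w 0%N + series (telescope w) n).
  by apply/funext => n; rewrite -eq_sum_telescope.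
by apply: is_cvgD => //; exact: is_cvg_cst.
Qed.

Section Convergence.
Context d (T : measurableType d) (R : realType).
Variable mu : {measure set T -> \bar R}.
Variables (D : set T) (v : T -> R).
Hypotheses (mD : measurable D) (mv : measurable_fun D v).
Hypothesis v0 : forall x, D x -> 0 <= v x.
Local Notation wp q f := (wpow mu v q D f).

(** The weighted p-th powers, rescaled by dyad j ^ p, form a summable series of
    integrals; its sum is then finite almost everywhere. *)
Lemma ae_dyadic_bound p (z : nat -> T -> R) : 0 < p ->
  (forall j, measurable_fun D (z j)) ->
  (forall j, (wp p (z j) <= (dyad j * dyad j `^ p)%:E)%E) ->
  {ae mu, forall x, D x -> v x != 0 -> exists C, forall j, `|z j x| <= C * dyad j}.
Proof.
move=> p0 mz Hz.
have dp0 j : 0 < dyad j `^ p :> R by rewrite powR_gt0// dyad_gt0.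
pose e j x : R := (dyad j `^ p)^-1 * (`|z j x| `^ p * v x).
have me j : measurable_fun D (e j).
  by apply: measurable_funM => //; exact: measurable_wpow.
have e0 j x : D x -> 0 <= e j x.
  by move=> Dx; rewrite mulr_ge0 ?invr_ge0 ?powR_ge0// mulr_ge0 ?powR_ge0 ?v0.
pose F x := (\sum_(j <oo) (e j x)%:E)%E.
have mF : measurable_fun D F.
  apply: (@ge0_emeasurable_sum _ _ _ D (fun j x => (e j x)%:E) xpredT).
    by move=> k x Dx _; rewrite lee_fin e0.
  by move=> k _; exact/measurable_EFinP.
have F0 x : D x -> (0 <= F x)%E.
  by move=> Dx; apply: nneseries_ge0 => n _ _; rewrite lee_fin e0.
have Fint : mu.-integrable D F.
  apply/integrableP; split => //.
  under eq_integral => x xD do (rewrite gee0_abs; last exact/F0/set_mem).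
  rewrite integral_nneseries//; last first.
    by move=> n; exact/measurable_EFinP.
  apply: (@le_lt_trans _ _ (\sum_(j <oo) (1 / (2 ^ j.+1)%:R)%:E)%E); last first.
    by apply: le_lt_trans (epsilon_trick0 xpredT ler01) _; rewrite ltry.
  apply: lee_nneseries => n *.
    by apply: integral_ge0 => x Dx; rewrite lee_fin e0.
  under eq_integral do rewrite EFinM.
  rewrite ge0_integralZl_EFin//; last 3 first.
  - by move=> x Dx; rewrite lee_fin mulr_ge0 ?powR_ge0 ?v0.
  - by apply/measurable_EFinP; exact: measurable_wpow.
  - by rewrite invr_ge0 ltW.
  apply: le_trans (lee_wpmul2l _ (Hz n)) _.
    by rewrite lee_fin invr_ge0 ltW.
  by rewrite -EFinM lee_fin mulrC mulfK ?gt_eqF.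
have := integrable_ae mD Fint; apply: filterS => x Ffin Dx vx0.
have vx : 0 < v x by rewrite lt_neqAle eq_sym vx0 v0.
exists ((fine (F x) / v x) `^ p^-1) => j.
have eF : e j x <= fine (F x).
  rewrite -lee_fin fineK ?Ffin//.
  apply: le_trans (nneseries_lim_ge j.+1 _); last by move=> n _ _; rewrite lee_fin e0.
  rewrite big_nat_recr//= leeDr//; apply: sume_ge0 => n _; by rewrite lee_fin e0.
have zE : `|z j x| = (`|z j x| `^ p) `^ p^-1.
  by rewrite -powRrM mulfV ?gt_eqF// powRr1.
have dE : dyad j = (dyad j `^ p) `^ p^-1 :> R.
  by rewrite -powRrM mulfV ?gt_eqF// powRr1// ltW// dyad_gt0.
have Fx0 : 0 <= fine (F x) by exact: fine_ge0 (F0 _ Dx).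
rewrite zE [in leRHS]dE -powRM ?divr_ge0 ?powR_ge0 ?(ltW vx)//.
apply: ler_powR2r; rewrite ?powR_ge0 ?invr_ge0 ?(ltW p0)//.
rewrite mulrAC ler_pdivlMr// -ler_pdivrMr// mulrC; exact: eF.
Qed.

(** Almost everywhere the integrand of f is at most the lower limit of those of
    w j: it vanishes where v x = 0 or f x = 0, and elsewhere the power function is
    continuous at |f x| > 0. *)
Lemma wpow_fatou q (w : nat -> T -> R) (f : T -> R) (c : \bar R) : 0 < q ->
  measurable_fun D f -> (forall j, measurable_fun D (w j)) ->
  {ae mu, forall x, D x -> v x != 0 -> w ^~ x @ \oo --> f x} ->
  (forall j, (wp q (w j) <= c)%E) -> (wp q f <= c)%E.
Proof.
move=> q0 mf mw wf wc.
pose g j x := (`|w j x| `^ q * v x)%:E.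
have mg j : measurable_fun D (g j) by apply/measurable_EFinP; exact: measurable_wpow.
have g0 j x : D x -> (0 <= g j x)%E.
  by move=> Dx; rewrite lee_fin mulr_ge0 ?powR_ge0 ?v0.
have li0 x : D x -> (0 <= limn_einf (g ^~ x))%E.
  move=> Dx; rewrite limn_einf_lim; apply: lime_ge; first exact: is_cvg_einfs.
  by apply: nearW => m; apply: le_ereal_inf_tmp => _ [n _ <-]; exact: g0.
have mli : measurable_fun D (fun x => limn_einf (g ^~ x)).
  have -> : (fun x => limn_einf (g ^~ x)) =
            (fun x => - limn_esup (fun j => - g j x))%E by [].
  apply: measurableT_comp => //; apply: measurable_fun_limn_esup => n.
  exact: measurableT_comp.
apply: (@le_trans _ _ (\int[mu]_(x in D) limn_einf (g ^~ x))%E); last first.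
  apply: le_trans (fatou mu mD mg g0) _.
  rewrite limn_einf_lim; apply: lime_le; first exact: is_cvg_einfs.
  apply: nearW => m; apply: le_trans (wc m).
  by apply: ereal_inf_lbound; exists m => /=.
apply: ae_ge0_le_integral => //.
- by move=> x Dx; rewrite lee_fin mulr_ge0 ?powR_ge0 ?v0.
- by apply/measurable_EFinP; exact: measurable_wpow.
move: wf; apply: filterS => x wf Dx.
have [vx0|vx0] := eqVneq (v x) 0; first by rewrite vx0 mulr0 li0.
have [fx0|fx0] := eqVneq (f x) 0.
  by rewrite fx0 normr0 powR0 ?gt_eqF// mul0r li0.
have fx : 0 < `|f x| by rewrite normr_gt0.
suff /cvg_limn_einf_sup[-> _] : g ^~ x @ \oo --> (`|f x| `^ q * v x)%:E by [].
apply: cvg_EFin; first by apply: nearW.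
have /derivable1_diffP/differentiable_continuous pc :
    derivable (@powR R ^~ q) `|f x| 1.
  by apply: derivable_powR; rewrite in_itv/= andbT.
suff H : (fun j => `|w j x| `^ q) @ \oo --> `|f x| `^ q.
  exact: (cvgM H (cvg_cst (v x))).
have nw : (fun j => `|w j x|) @ \oo --> `|f x| by apply: cvg_norm; exact: wf.
exact: (continuous_cvg _ pc nw).
Qed.

Lemma ae_limit_of_dyadic_steps p (w : nat -> T -> R) : 0 < p ->
  (forall j, measurable_fun D (w j)) ->
  (forall j, (wp p (w j.+1 \- w j)%R <= (dyad j * dyad j `^ p)%:E)%E) ->
  exists2 g : T -> R, measurable_fun D g &
    {ae mu, forall x, D x -> v x != 0 -> w ^~ x @ \oo --> g x}.
Proof.
move=> p0 mw Hw.
(* the upper limit is measurable on all of D and equals the limit where the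
   latter exists *)
exists (fun x => fine (limn_esup (fun j => (w j x)%:E))).
  apply: measurableT_comp => //.
  apply: (@measurable_fun_limn_esup _ _ _ D (fun j x => (w j x)%:E)) => n.
  exact/measurable_EFinP.
have := ae_dyadic_bound p0 (fun j => measurable_funB (mw j.+1) (mw j)) Hw.
apply: filterS => x Hx Dx vx; have [C HC] := Hx Dx vx.
have /cvg_ex[l wl] := cvg_of_dyadic_steps HC.
suff -> : limn_esup (fun j => (w j x)%:E) = l%:E by [].
apply: (cvg_limn_einf_sup _).2; apply: cvg_EFin => //; exact: nearW.
Qed.

Lemma ae_cvg_of_dyadic_dist p (w : nat -> T -> R) (f : T -> R) : 0 < p ->
  measurable_fun D f -> (forall j, measurable_fun D (w j)) ->
  (forall j, (wp p (w j \- f)%R <= (dyad j * dyad j `^ p)%:E)%E) ->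
  {ae mu, forall x, D x -> v x != 0 -> w ^~ x @ \oo --> f x}.
Proof.
move=> p0 mf mw Hw.
have := ae_dyadic_bound p0 (fun j => measurable_funB (mw j) mf) Hw.
apply: filterS => x Hx Dx vx; have [C HC] := Hx Dx vx.
apply/subr_cvg0; apply/norm_cvg0P.
apply: (squeeze_cvgr _ (cvg_cst (0 : R)) (cvg_dyad0 C)).
by apply: nearW => j; rewrite normr_ge0; exact: HC.
Qed.

End Convergence.

Section Completeness.
Context d (T : measurableType d) (R : realType).
Variable mu : {measure set T -> \bar R}.
Variables (D : set T) (v : T -> R).
Hypotheses (mD : measurable D) (mv : measurable_fun D v).
Hypothesis v0 : forall x, D x -> 0 <= v x.
Hypothesis vD : (\int[mu]_(x in D) (v x)%:E < +oo)%E.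
Local Notation wp q f := (wpow mu v q D f).

Lemma wpow_lty_of_higher q r f : 0 < q < r -> measurable_fun D f ->
  (wp r f < +oo)%E -> (wp q f < +oo)%E.
Proof.
move=> /andP[q0 qr] mf fr; apply: (@le_lt_trans _ _
  (1%:E * wp r f + \int[mu]_(x in D) (v x)%:E)%E); last first.
  by rewrite mul1e lte_add_pinfty.
apply: lower_integral_le_lin => //.
- by move=> x Dx; rewrite mulr_ge0 ?powR_ge0 ?v0.
- by move=> x Dx; rewrite mulr_ge0 ?powR_ge0 ?v0.
move=> x Dx; rewrite mul1r -[X in _ + X]mul1r -mulrDl ler_wpM2r ?v0//.
have [f1|f1] := leP `|f x| 1.
  rewrite ler_wpDl ?powR_ge0//.
  by have := ler_powR2r (ltW q0) (normr_ge0 _) f1; rewrite powR1.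
by rewrite ler_wpDr//; apply: ler_powR; exact: ltW.
Qed.

(** The limit exists almost everywhere because the steps are summable; Fatou's
    lemma turns the Cauchy bound and the bound in the higher power into bounds
    for the limit, and interpolation handles all powers below the higher one. *)
Lemma wpow_complete p q r (M : R) (w : nat -> T -> R) :
  0 < p < r -> 0 < q < r -> (forall j, measurable_fun D (w j)) ->
  (forall j, (wp r (w j) <= M%:E)%E) ->
  (forall k i j, (k <= i)%N -> (k <= j)%N ->
     (wp p (w i \- w j)%R <= (dyad k * dyad k `^ p)%:E)%E) ->
  exists g : T -> R, [/\ measurable_fun D g, (wp q g < +oo)%E &
    forall e : R, 0 < e -> \forall j \near \oo, (wp q (w j \- g)%R <= e%:E)%E].
Proof.
move=> /andP[p0 pr] /andP[q0 qr] mw Mw cw.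
have r0 : 0 < r by exact: lt_trans pr.
have [g mg wg] : exists2 g : T -> R, measurable_fun D g &
    {ae mu, forall x, D x -> v x != 0 -> w ^~ x @ \oo --> g x}.
  apply: (ae_limit_of_dyadic_steps mD mv v0 p0 mw) => j.
  exact: cw.
have Mg : (wp r g <= M%:E)%E by exact: (wpow_fatou mD mv v0 r0 mg mw wg).
exists g; split => //.
  by apply: (wpow_lty_of_higher (r := r)) => //; rewrite ?q0//; apply: le_lt_trans Mg _; rewrite ltry.
have pw k : (wp p (w k \- g)%R <= (dyad k * dyad k `^ p)%:E)%E.
  apply: (wpow_fatou mD mv v0 p0 (w := fun j => w k \- w (j + k)%N)).
  - exact: measurable_funB.
  - by move=> j; exact: measurable_funB.
  - move: wg; apply: filterS => x wx Dx vx.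
    have H : (fun j => w (j + k)%N x) @ \oo --> g x.
      by rewrite (cvg_shiftn k (w^~ x)); exact: wx.
    exact: (cvgB (cvg_cst (w k x)) H).
  - by move=> j; apply: cw; rewrite ?leq_addl.
have M0 : 0 <= M by rewrite -lee_fin; apply: le_trans (Mw 0%N); exact: wpow_ge0.
have rw k : (wp r (w k \- g)%R <= (2 `^ r * (M + M))%:E)%E.
  apply: le_trans (wpow_le_add mu mD mv v0 (f := w k \- g) r0 (mw k) mg _) _.
    by move=> x _; exact: ler_normB.
  rewrite (EFinM (2 `^ r)) (EFinD M M).
  apply: lee_wpmul2l; first by rewrite lee_fin; exact: powR_ge0.
  exact: leeD (Mw k) Mg.
move=> e e0.
pose V := fine (\int[mu]_(x in D) (v x)%:E)%E.
have VE : (\int[mu]_(x in D) (v x)%:E = V%:E)%E.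
  rewrite fineK// ge0_fin_numE//; apply: integral_ge0 => x Dx.
  by rewrite lee_fin v0.
have V0 : 0 <= V by apply: fine_ge0; apply: integral_ge0 => x Dx; rewrite lee_fin v0.
pose K := V + 2 `^ r * (M + M) + 1.
have K0 : 0 < K.
  by rewrite /K ltr_wpDl// addr_ge0// mulr_ge0 ?powR_ge0 ?addr_ge0.
have eK : 0 < e / 2 / K by rewrite !divr_gt0.
have [|C C0 HC] := @wpow_interpolation _ _ _ mu D v mD mv v0 p q r _ p0 _ eK.
  by rewrite q0.
have : \forall j \near \oo, C * dyad j < e / 2 :> R.
  have e2 : 0 < e / 2 by rewrite divr_gt0.
  have /cvgrPdist_lt/(_ _ e2) := cvg_dyad0 C.
  by apply: filterS => j /=; rewrite sub0r normrN; exact: le_lt_trans (ler_norm _).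
apply: filterS => j Cj.
apply: le_trans (HC _ (measurable_funB (mw j) mg)) _.
rewrite VE; apply: (@le_trans _ _
  ((e / 2 / K)%:E * (V%:E + (2 `^ r * (M + M))%:E) + C%:E * (dyad j)%:E)%E).
  apply: leeD.
    by rewrite lee_wpmul2l ?lee_fin ?(ltW eK)// leeD2l.
  rewrite lee_wpmul2l ?lee_fin ?(ltW C0)//; apply: le_trans (pw j) _.
  rewrite lee_fin ler_piMr ?(ltW (dyad_gt0 _))//.
  have d1 : dyad j <= 1 :> R.
    by rewrite /dyad ler_pdivrMr ?ltr0n ?expn_gt0// mul1r ler1n expn_gt0.
  have := ler_powR2r (ltW p0) (ltW (dyad_gt0 j)) d1; by rewrite powR1.
rewrite -(EFinD V) -!EFinM -EFinD lee_fin.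
have : e / 2 / K * (V + 2 `^ r * (M + M)) <= e / 2.
  rewrite mulrAC ler_pdivrMr// ler_wpM2l ?divr_ge0 ?(ltW e0)//.
  by rewrite /K lerDl.
by move=> H; rewrite [leRHS]splitr; exact: lerD H (ltW Cj).
Qed.

End Completeness.

(** * Ultrafilters on the natural numbers *)

Section Ultrafilter.

Lemma free_ultrafilter :
  exists U : set_system nat, UltraFilter U /\ (\oo `<=` U).
Proof. by have [U [UU oU]] := ultraFilterLemma eventually_filter; exists U. Qed.

(** By compactness the image of the ultrafilter has a cluster point l, and an
    ultrafilter contains either a set or its complement: the indices far from l
    cannot form a member, so those close to l do. *)
Lemma ultrafilter_near_constant {R : realType} (U : set_system nat)
    (m : nat -> R) (M e : R) :
  UltraFilter U -> (forall j, `|m j| <= M) -> 0 < e ->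
  exists2 A, U A & forall i j, A i -> A j -> `|m i - m j| <= e.
Proof.
move=> UU mM e0.
have [l [_ ml]] : (`[- M, M]%classic `&` cluster (m @ U)) !=set0.
  apply: (@segment_compact R (- M) M).
  by apply: (@filterE _ U) => j; rewrite /= in_itv/= -ler_norml mM.
have e20 : 0 < e / 2 by rewrite divr_gt0.
exists [set j | `|l - m j| < e / 2].
  have [//|UC] := in_ultra_setVsetC [set j | `|l - m j| < e / 2] UU.
  have [y [/= + ly]] := ml [set y | ~ (`|l - y| < e / 2)] (ball l (e / 2)) UC
    (nbhsx_ballx _ _ e20).
  by case.
move=> i j /= li lj.
have -> : m i - m j = (l - m j) - (l - m i) by ring.
apply: le_trans (ler_normB _ _) _; lra.
Qed.

(** The members A 0, ..., A k have an infinite intersection B k, from which the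
    k-th index is taken beyond the previous one; thus all indices from the k-th
    on lie in A k. *)
Lemma ultrafilter_extraction (U : set_system nat) (P : nat -> nat -> nat -> Prop) :
  ProperFilter U -> \oo `<=` U ->
  (forall k, exists2 A, U A & forall i j, A i -> A j -> P k i j) ->
  exists2 phi : nat -> nat, {homo phi : i j / (i < j)%N} &
    forall k i j, (k <= i)%N -> (k <= j)%N -> P k (phi i) (phi j).
Proof.
move=> UU oU PA.
have /choice[A HA] k : exists A, U A /\ forall i j, A i -> A j -> P k i j.
  by have [A UA AP] := PA k; exists A.
have UA k : U (A k) by case: (HA k).
have AP k i j : A k i -> A k j -> P k i j by case: (HA k) => _; apply.
pose B k := [set n | forall l, (l <= k)%N -> A l n].
have UB k : U (B k).
  elim: k => [|k IH].
    by apply: filterS (UA 0%N) => n An l; rewrite leqn0 => /eqP ->.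
  apply: filterS (filterI IH (UA k.+1)) => n [Bn An] l.
  by rewrite leq_eqVlt => /orP[/eqP->//|]; exact: Bn.
have next (kn : nat * nat) : exists m, B kn.1 m /\ (kn.2 < m)%N.
  have Un : U [set m | (kn.2 < m)%N] by apply: oU; exists kn.2.+1.
  by have [m [Bm nm]] := @filter_ex _ U _ _ (filterI (UB kn.1) Un); exists m.
have [f0 Hf0] := choice next; pose f k n := f0 (k, n).
have fB k n : B k (f k n) by case: (Hf0 (k, n)).
have fn k n : (n < f k n)%N by case: (Hf0 (k, n)).
pose phi := fix phi k := match k with 0 => f 0%N 0%N | k'.+1 => f k (phi k') end.
have phiB k : B k (phi k) by case: k => [|k]; exact: fB.
exists phi.
  by apply: homo_ltn => [i j k|k]; [exact: ltn_trans|exact: fn].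
by move=> k i j ki kj; apply: AP; exact: phiB.
Qed.

End Ultrafilter.

Lemma ultrafilter_near_constant_seq {R : realType} {I : eqType} (s : seq I)
    (U : set_system nat) (m : I -> nat -> R) (e : R) :
  UltraFilter U -> (forall x, x \in s -> exists M, forall j, `|m x j| <= M) -> 0 < e ->
  exists2 A, U A & forall x, x \in s -> forall i j, A i -> A j -> `|m x i - m x j| <= e.
Proof.
move=> UU; elim: s => [|x s IH] Hm e0; first by exists setT => //; exact: filterT.
have [|//|A UA HA] := IH; first by move=> y ys; apply: Hm; rewrite inE ys orbT.
have [M HM] := Hm x (mem_head _ _).
have [A' UA' HA'] := ultrafilter_near_constant UU HM e0.
exists (A `&` A'); first exact: filterI.
move=> y; rewrite inE => /predU1P[->|ys] i j [Ai A'i] [Aj A'j]; first exact: HA'.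
exact: HA.
Qed.

(** * The Euclidean norm and square roots of matrices *)

Section EuclideanNorm.
Context {R : realType} {n : nat}.
Implicit Types (a b c xi : 'cV[R]_n) (A Q S : 'M[R]_n).

Lemma sqr_enorm c : enorm c ^+ 2 = \sum_i c i 0 ^+ 2.
Proof. by rewrite sqr_sqrtr// sumr_ge0// => i _; rewrite sqr_ge0. Qed.

Lemma enorm_ge0 c : 0 <= enorm c.
Proof. exact: sqrtr_ge0. Qed.

Lemma enorm_le_sqr c (M : R) : 0 <= M -> \sum_i c i 0 ^+ 2 <= M ^+ 2 -> enorm c <= M.
Proof. by move=> M0 H; rewrite -(ler_sqr (enorm_ge0 c) M0) sqr_enorm. Qed.

Lemma enormZ (k : R) c : enorm (k *: c) = `|k| * enorm c.
Proof.
rewrite /enorm -sqrtr_sqr -sqrtrM ?sqr_ge0// mulr_sumr.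
by congr (Num.sqrt _); apply: eq_bigr => i _; rewrite mxE exprMn.
Qed.

Lemma coord_le_enorm c i : `|c i 0| <= enorm c.
Proof.
rewrite -(ler_sqr (normr_ge0 _) (enorm_ge0 _)) sqr_enorm real_normK ?num_real//.
by rewrite (bigD1 i)//= lerDl sumr_ge0// => j _; rewrite sqr_ge0.
Qed.

Lemma enorm_le_coord c (M : R) : (forall i, `|c i 0| <= M) -> 0 <= M ->
  enorm c <= n%:R * M.
Proof.
move=> cM M0; apply: enorm_le_sqr; first by rewrite mulr_ge0.
apply: (@le_trans _ _ (\sum_(i < n) M ^+ 2)).
  apply: ler_sum => i _; rewrite -real_normK ?num_real//.
  by rewrite ler_sqr ?nnegrE.
rewrite sumr_const card_ord -[leLHS]mulr_natl exprMn ler_wpM2r ?sqr_ge0//.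
by rewrite -natrX ler_nat -mulnn; case: (n) => // m; rewrite leq_pmull.
Qed.

Lemma enorm_eq0 c : enorm c = 0 -> c = 0.
Proof.
move=> c0; apply/colP => i; rewrite mxE; apply/eqP.
by rewrite -normr_le0 -c0 coord_le_enorm.
Qed.

Lemma enorm0 : enorm (0 : 'cV[R]_n) = 0.
Proof. by rewrite -(scale0r (0 : 'cV_n)) enormZ normr0 mul0r. Qed.

Lemma enormD_le a b : enorm (a + b) <= 2 * (enorm a + enorm b).
Proof.
have a0 := enorm_ge0 a; have b0 := enorm_ge0 b.
apply: enorm_le_sqr; first by rewrite mulr_ge0 ?addr_ge0.
apply: (@le_trans _ _ (2 * (enorm a ^+ 2 + enorm b ^+ 2))).
  rewrite !sqr_enorm -big_split/= mulr_sumr; apply: ler_sum => i _.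
  rewrite mxE; have := sqr_ge0 (a i 0 - b i 0); nra.
nra.
Qed.

Lemma opnorm_has_ubound A :
  has_ubound [set enorm (A *m xi) | xi in [set xi | enorm xi = 1]].
Proof.
pose M := \sum_i \sum_j `|A i j|.
exists (n%:R * M) => _ [xi /= xi1 <-]; apply: enorm_le_coord; last first.
  by apply: sumr_ge0 => i _; exact: sumr_ge0.
move=> i; rewrite mxE; apply: le_trans (ler_norm_sum _ _ _) _.
rewrite /M [leRHS](bigD1 i)//= ler_wpDr//.
  by apply: sumr_ge0 => k _; exact: sumr_ge0.
apply: ler_sum => j _; rewrite normrM ler_piMr// -xi1; exact: coord_le_enorm.
Qed.

Lemma opnorm_ge0 A : 0 <= opnorm A.
Proof.
have [[xi xi1]|H] := pselect (exists xi : 'cV[R]_n, enorm xi = 1).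
  apply: (le_trans (enorm_ge0 (A *m xi))); apply: ub_le_sup.
    exact: opnorm_has_ubound.
  by exists xi.
rewrite /opnorm (_ : [set _ | _ in _] = set0) ?sup0//.
by rewrite -subset0 => _ [xi /= xi1 _]; apply: H; exists xi.
Qed.

Lemma enorm_mulmx_le A c : enorm (A *m c) <= opnorm A * enorm c.
Proof.
have [c0|c0] := eqVneq (enorm c) 0; first by rewrite (enorm_eq0 c0) mulmx0 enorm0 mulr0.
have cp : 0 < enorm c by rewrite lt_neqAle eq_sym c0 enorm_ge0.
rewrite -ler_pdivrMr//; apply: ub_le_sup; first exact: opnorm_has_ubound.
exists ((enorm c)^-1 *: c) => /=.
  by rewrite enormZ ger0_norm ?invr_ge0 ?enorm_ge0// mulVf.
by rewrite -scalemxAr enormZ ger0_norm ?invr_ge0 ?enorm_ge0// mulrC.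
Qed.

(** If S is a symmetric square root of Q, the square of |S c| is the quadratic
    form of Q at c.  The default value of sqrtmx is 0, for which the bound is
    trivial. *)
Lemma sqr_enorm_sqrtmx_le Q c :
  enorm (sqrtmx Q *m c) ^+ 2 <= n%:R * opnorm Q * enorm c ^+ 2.
Proof.
rewrite /sqrtmx; case: xgetP => [S _ [[ST _] SQ]|_]; last first.
  rewrite mul0mx enorm0 expr2 mul0r.
  by apply: mulr_ge0; [rewrite mulr_ge0 ?opnorm_ge0|exact: sqr_ge0].
have -> : enorm (S *m c) ^+ 2 = \sum_i c i 0 * (Q *m c) i 0.
  transitivity (((S *m c)^T *m (S *m c)) 0 0).
    by rewrite [RHS]mxE sqr_enorm; apply: eq_bigr => i _; rewrite [(_^T) _ _]mxE expr2.
  rewrite trmx_mul ST -mulmxA (mulmxA S) SQ mxE.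
  by apply: eq_bigr => i _; rewrite [(_^T) _ _]mxE.
have -> : n%:R * opnorm Q * enorm c ^+ 2 =
    \sum_(i < n) (enorm c * (opnorm Q * enorm c)).
  by rewrite sumr_const card_ord -[RHS]mulr_natl; ring.
apply: ler_sum => i _; apply: le_trans (ler_norm _) _; rewrite normrM.
apply: ler_pM => //; first exact: coord_le_enorm.
exact: le_trans (coord_le_enorm _ _) (enorm_mulmx_le _ _).
Qed.

Lemma powR_enorm_sqrtmx_le Q c (p k w : R) : 0 <= p ->
  opnorm Q `^ (p / 2) <= k * w -> 0 <= k * w ->
  enorm (sqrtmx Q *m c) `^ p <= n%:R `^ (p / 2) * k * (enorm c `^ p * w).
Proof.
move=> p0 Qkw kw0.
have sq (t : R) : 0 <= t -> t `^ p = (t ^+ 2) `^ (p / 2).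
  by move=> t0; rewrite -powR_mulrn// -powRrM mulrCA mulfV ?mulr1.
rewrite sq ?enorm_ge0//.
apply: (@le_trans _ _ ((n%:R * opnorm Q * enorm c ^+ 2) `^ (p / 2))).
  apply: ge0_ler_powR; rewrite ?nnegrE ?divr_ge0 ?sqr_ge0 ?sqr_enorm_sqrtmx_le//.
  by apply: mulr_ge0; [rewrite mulr_ge0 ?opnorm_ge0|exact: sqr_ge0].
rewrite powRM ?mulr_ge0 ?opnorm_ge0 ?enorm_ge0//.
rewrite -sq ?enorm_ge0// powRM ?opnorm_ge0//.
have -> : n%:R `^ (p / 2) * k * (enorm c `^ p * w) =
  n%:R `^ (p / 2) * (k * w) * enorm c `^ p by ring.
by rewrite ler_wpM2r ?powR_ge0// ler_wpM2l ?powR_ge0.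
Qed.

End EuclideanNorm.

(** * Locally Lipschitz functions and their partial derivatives *)

Section LocallyLipschitzFacts.
Context {R : realType} {n : nat}.
Let E := 'rV[R]_n.
Implicit Types (A : set E) (f g : E -> R) (x y z e : E).

Lemma norm_rVE x : `|x| = \big[Num.max/0]_ij `|x ij.1 ij.2|.
Proof. exact: mx_normrE. Qed.

Lemma coord_le_norm x i : `|x 0 i| <= `|x|.
Proof.
rewrite norm_rVE.
exact: (le_bigmax 0 (fun ij : 'I_1 * 'I_n => `|x ij.1 ij.2|) (0, i)).
Qed.

Lemma norm_delta_le1 (i : 'I_n) : `|(delta_mx 0 i : E)| <= 1.
Proof.
rewrite norm_rVE; apply: bigmax_le => [|[k j] _]; first exact: ler01.
by rewrite mxE /=; case: (_ && _); rewrite ?normr1 ?normr0.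
Qed.

Lemma loc_lipschitzP A f : loc_lipschitz A f <->
  forall x, A x -> exists U, nbhs x U /\ exists2 k : R, 0 <= k &
    forall y z, (A `&` U) y -> (A `&` U) z -> `|f y - f z| <= k * `|y - z|.
Proof.
split=> H x Ax; have := H x Ax.
  move=> [U xU [k [kr kP]]]; exists U; split => //; exists (Num.max 0 (k + 1)).
    by rewrite le_max lexx.
  have kk : k < k + 1 by rewrite ltrDl.
  move=> y z Ay Az; have := kP (k + 1) kk (y, z) (conj Ay Az).
  move=> /= /le_trans; apply; rewrite ler_wpM2r//.
  by rewrite le_max lexx orbT.
move=> [U [xU [k k0 kP]]]; exists U => //; exists k; split => //; first exact: num_real.
move=> M kM [y z] /= [Ay Az]; apply: le_trans (kP _ _ Ay Az) _.
by rewrite ler_wpM2r// ltW.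
Qed.

Lemma loc_lipschitz_continuous A f x : open A -> loc_lipschitz A f -> A x ->
  {for x, continuous f}.
Proof.
move=> oA /loc_lipschitzP fl Ax; have [U [xU [k k0 kP]]] := fl x Ax.
apply/(@cvgrPdist_le _ _ _ (nbhs x) _ f (f x)) => e e0.
have k10 : 0 < k + 1 by rewrite ltr_wpDl.
have AU : nbhs x (A `&` U) by apply: filterI => //; exact: open_nbhs_nbhs.
have ek : 0 < e / (k + 1) by rewrite divr_gt0.
have Bx := nbhsx_ballx x _ ek.
near=> y.
have AUy : (A `&` U) y by near: y.
have : ball x (e / (k + 1)) y by near: y.
rewrite mx_norm_ball /ball_/= => xy.
apply: le_trans (kP _ _ (nbhs_singleton AU) AUy) _.
have := ltW xy; rewrite ler_pdivlMr// => {}xy; apply: le_trans xy.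
by rewrite mulrC ler_wpM2l// lerDl.
Unshelve. all: by end_near. Qed.

Lemma loc_lipschitz_sub A B f : A `<=` B -> loc_lipschitz B f -> loc_lipschitz A f.
Proof.
move=> AB /loc_lipschitzP H; apply/loc_lipschitzP => x Ax.
have [U [xU [k k0 kP]]] := H x (AB _ Ax); exists U; split => //; exists k => //.
by move=> y z [Ay Uy] [Az Uz]; apply: kP; split => //; exact: AB.
Qed.

Lemma loc_lipschitz_mul A f g (L B : R) : 0 <= L -> 0 <= B ->
  loc_lipschitz A f -> (forall y z, A y -> A z -> `|g y - g z| <= L * `|y - z|) ->
  (forall y, A y -> `|g y| <= B) -> loc_lipschitz A (fun y => f y * g y).
Proof.
move=> L0 B0 /loc_lipschitzP fl gl gB; apply/loc_lipschitzP => x Ax.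
have [U [xU [k k0 kP]]] := fl x Ax.
exists (U `&` ball x 1); split.
  by apply: filterI => //; apply: nbhsx_ballx.
exists ((`|f x| + k) * L + B * k); first by rewrite addr_ge0 ?mulr_ge0 ?addr_ge0.
move=> y z [Ay [Uy xy]] [Az [Uz xz]].
have fy : `|f y| <= `|f x| + k.
  have := kP y x (conj Ay Uy) (conj Ax (nbhs_singleton xU)).
  move: xy; rewrite mx_norm_ball /ball_/= distrC => /ltW xy H.
  rewrite -(subrK (f x) (f y)) addrC; apply: le_trans (ler_normD _ _) _.
  by rewrite lerD2l; apply: le_trans H _; rewrite ler_piMr.
have -> : f y * g y - f z * g z = f y * (g y - g z) + g z * (f y - f z) by ring.
apply: le_trans (ler_normD _ _) _; rewrite !normrM mulrDl; apply: lerD.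
  by rewrite -mulrA; apply: ler_pM => //; exact: gl.
by rewrite -mulrA; apply: ler_pM => //; [exact: gB|exact: kP].
Qed.

Lemma cvg_line x e : (fun h : R => h *: e + x) @ (0 : R)^' --> x.
Proof.
have c0 : (fun h : R => h *: e + x) @ (0 : R) --> 0 *: e + x.
  apply: cvgD; last exact: cvg_cst.
  by apply: cvgZr_tmp; exact: cvg_id.
rewrite scale0r add0r in c0; move=> A /c0; exact: nbhs_dnbhs.
Qed.

Lemma norm_derive_le A f (L : R) x e : open A -> A x -> 0 <= L ->
  (forall y z, A y -> A z -> `|f y - f z| <= L * `|y - z|) ->
  `|e| <= 1 -> derivable f x e -> `|'D_e f x| <= L.
Proof.
move=> oA Ax L0 fL e1 fd.
have H : `|h^-1 *: (f (h *: e + x) - f x)| @[h --> (0 : R)^'] --> `|'D_e f x|.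
  by apply: cvg_norm; exact: fd.
have /cvg_lim <- // := H.
apply: limr_le; first by apply/cvg_ex; eexists; exact: H.
have Axe : \forall h \near (0 : R)^', A (h *: e + x).
  have Ax' : nbhs x A by exact: open_nbhs_nbhs.
  by have := @cvg_line x e A Ax'.
have h0 : \forall h \near (0 : R)^', h != 0 by exact: nbhs_dnbhs_neq.
apply: filterS2 Axe h0 => h Ah hn0 /=.
rewrite normrZ normfV ler_pdivrMl ?normr_gt0//.
apply: le_trans (fL _ _ Ah Ax) _; rewrite addrK normrZ mulrCA ler_wpM2l//.
by rewrite ler_piMr.
Qed.

(** Where f has no derivative, neither has the product with g unless g vanishes
    there; the derivative of such a function is the default value 0. *)
Lemma derive_mul_default f g x e : {for x, continuous f} ->
  {for x, continuous g} -> derivable g x e ->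
  exists2 c : R, `|c| <= `|f x| * `|'D_e g x| &
    'D_e (fun y => f y * g y) x = g x * 'D_e f x + c.
Proof.
move=> fc gc dg.
have [gx0|gx0] := eqVneq (g x) 0.
  exists (f x * 'D_e g x); first by rewrite normrM.
  rewrite gx0 mul0r add0r; apply/cvg_lim => //.
  have fh : (fun h : R => f (h *: e + x)) @ (0 : R)^' --> f x.
    exact: (cvg_comp _ _ (@cvg_line x e) fc).
  apply: cvg_trans (cvgM fh dg); apply: near_eq_cvg; near=> h.
  by rewrite /= gx0 mulr0 !subr0 /GRing.scale/= mulrCA.
have [df|ndf] := pselect (derivable f x e).
  exists (f x * 'D_e g x); first by rewrite normrM.
  by rewrite (deriveM df dg) addrC.
exists 0; first by rewrite normr0 mulr_ge0.
have nd : ~ derivable (fun y => f y * g y) x e.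
  move=> dfg; apply: ndf.
  apply: (@near_eq_derivable _ _ _ (fun y => f y * g y * (g y)^-1)).
    have : \forall y \near x, g y != 0 by exact: cvgr_neq0 gc gx0.
    by apply: filterS => y gy0; rewrite mulfK.
  exact: derivableM dfg (derivableV gx0 dg).
by rewrite addr0 /derive (dvgP nd) (dvgP ndf) mulr0.
Unshelve. all: by end_near. Qed.

End LocallyLipschitzFacts.

Section Borel.
Context {R : realType} {n : nat}.
Let E := 'rV[R]_n.
Context {G : set (set E)}.
Let T := g_sigma_algebraType G.
Hypothesis openG : forall U : set E, open U -> <<s G >> U.

Lemma open_measurable_G (U : set E) : open U -> measurable (U : set T).
Proof. exact: openG. Qed.

Lemma loc_lipschitz_measurable (Omega : set E) (f : E -> R) : open Omega ->
  loc_lipschitz Omega f -> measurable_fun (Omega : set T) (f : T -> R).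
Proof.
move=> oO fl mO; apply: (measurability _ (RGenOInfty.measurableE R)) => //.
move=> _ [_ [r ->] <-]; apply: open_measurable_G.
rewrite openE => x [Ox /=]; rewrite in_itv/= andbT => rx.
have fc := loc_lipschitz_continuous oO fl Ox.
apply: filterI; first exact: open_nbhs_nbhs.
have : nbhs (f x) `]r, +oo[%classic.
  by apply: open_nbhs_nbhs; split => //=; rewrite in_itv/= andbT.
exact: fc.
Qed.

End Borel.

(** * A differentiable cutoff *)

Section Cutoff.
Context {R : realType} {n : nat}.
Let E := 'rV[R]_n.
Implicit Types (a x y z e : E) (s t : R).

Definition sqpos t : R := Num.max 0 t ^+ 2.

(** The derivative 2 max(0,t) is 2-Lipschitz, which bounds the remainder
    uniformly, also across 0. *)
Lemma sqpos_taylor t h : `|sqpos (h + t) - sqpos t - h * (2 * Num.max 0 t)| <= h ^+ 2.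
Proof.
rewrite /sqpos ler_norml; case: (leP 0 t) => t0; case: (leP 0 (h + t)) => ht0.
- by apply/andP; split; nra.
- by apply/andP; split; nra.
- by apply/andP; split; nra.
- by apply/andP; split; nra.
Qed.

Lemma derivable_sqpos t : derivable sqpos t 1.
Proof.
apply/cvg_ex; exists (2 * Num.max 0 t).
apply/(@cvgrPdist_le _ _ _ ((0 : R)^')) => e e0; near=> h.
have h0 : h != 0 by near: h; exact: nbhs_dnbhs_neq.
have he : `|h| <= e by near: h; exact: dnbhs0_le.
apply: le_trans he; rewrite /GRing.scale/= mulr1.
have -> : 2 * Num.max 0 t - h^-1 * (sqpos (h + t) - sqpos t) =
  - (h^-1 * (sqpos (h + t) - sqpos t - h * (2 * Num.max 0 t))).
  by rewrite [in RHS]mulrBr mulKf// opprB.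
rewrite normrN normrM normfV ler_pdivrMl ?normr_gt0//.
by apply: le_trans (sqpos_taylor t h) _; rewrite -normrM -expr2 ler_norm.
Unshelve. all: by end_near. Qed.

Lemma sqpos_ge0 t : 0 <= sqpos t.
Proof. exact: sqr_ge0. Qed.

Lemma sqpos_lip t1 t2 (b : R) : t1 <= b -> t2 <= b -> 0 <= b ->
  `|sqpos t1 - sqpos t2| <= 2 * b * `|t1 - t2|.
Proof.
move=> t1b t2b b0; rewrite /sqpos subr_sqr normrM mulrC.
have m1 : Num.max 0 t1 <= b by rewrite ge_max b0.
have m2 : Num.max 0 t2 <= b by rewrite ge_max b0.
have m10 : 0 <= Num.max 0 t1 by rewrite le_max lexx.
have m20 : 0 <= Num.max 0 t2 by rewrite le_max lexx.
apply: ler_pM => //.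
  by rewrite ger0_norm ?addr_ge0//; move: m1 m2; lra.
move=> {m1 m2 m10 m20}.
by case: (leP 0 t1) => h1; case: (leP 0 t2) => h2; rewrite ler_norml;
  case: (ler0P (t1 - t2)) => h3; apply/andP; split; lra.
Qed.

(** The profile is squared so that it is differentiable everywhere, including at
    the boundary of the support. *)
Definition cutoff a s y : R := sqpos (s ^+ 2 - \sum_i (y 0 i - a 0 i) ^+ 2).

Lemma differentiable_cutoff a s y : differentiable (cutoff a s) y.
Proof.
pose g (y : E) := s ^+ 2 - \sum_i (y 0 i - a 0 i) ^+ 2.
have dg : differentiable g y.
  apply: (@differentiableB _ _ _ (cst (s ^+ 2)) (fun y : E => \sum_i (y 0 i - a 0 i) ^+ 2)).
    exact: differentiable_cst.
  have -> : (fun y : E => \sum_i (y 0 i - a 0 i) ^+ 2) =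
      \sum_(i < n) (fun y : E => (y 0 i - a 0 i) ^+ 2).
    by apply/funext => z; rewrite fct_sumE.
  apply: differentiable_sum => i.
  pose l (y : E) := y 0 i - a 0 i.
  have -> : (fun y : E => (y 0 i - a 0 i) ^+ 2) = l * l.
    by apply/funext => z; rewrite expr2.
  suff dl : differentiable l y by exact: differentiableM.
  apply: (@differentiableB _ _ _ (fun y : E => y 0 i) (cst (a 0 i))).
    exact: differentiable_coord.
  exact: differentiable_cst.
apply: (@differentiable_comp _ _ _ _ g sqpos) => //.
exact/derivable1_diffP/derivable_sqpos.
Qed.

Lemma cutoff_center a s : cutoff a s a = s ^+ 4.
Proof.
rewrite /cutoff big1 => [|i _]; last by rewrite subrr expr0n.
rewrite subr0 /sqpos; case: (leP 0 (s ^+ 2)) => [_|]; first by rewrite -exprM.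
by rewrite ltNge sqr_ge0.
Qed.

Lemma cutoff_ge0 a s y : 0 <= cutoff a s y.
Proof. exact: sqpos_ge0. Qed.

Lemma cutoff_le a s y : cutoff a s y <= s ^+ 4.
Proof.
rewrite /cutoff /sqpos (_ : s ^+ 4 = (s ^+ 2) ^+ 2); last by rewrite -exprM.
rewrite ler_sqr ?nnegrE ?sqr_ge0 ?le_max ?lexx// ge_max sqr_ge0/= gerBl.
by apply: sumr_ge0 => i _; rewrite sqr_ge0.
Qed.

Lemma cutoff_neq0 a s y : 0 < s -> cutoff a s y != 0 -> `|y - a| <= s.
Proof.
move=> s0; rewrite /cutoff /sqpos sqrf_eq0.
case: (leP 0 (s ^+ 2 - _)) => [|_]; last by rewrite eqxx.
rewrite subr_ge0 => H _; rewrite norm_rVE; apply: bigmax_le => [|[k i] _]; first exact: ltW.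
rewrite !ord1 /= !mxE -(ler_sqr (normr_ge0 _) (ltW s0)) real_normK ?num_real//.
apply: le_trans H; rewrite (bigD1 i)//= lerDl sumr_ge0// => j _; exact: sqr_ge0.
Qed.

Lemma cutoff_lip a s (M : R) : exists2 L : R, 0 <= L & forall y z,
  `|y| <= M -> `|z| <= M -> `|cutoff a s y - cutoff a s z| <= L * `|y - z|.
Proof.
have [M0|M0] := leP 0 M; last first.
  exists 0 => // y z yM; by have := le_lt_trans yM M0; rewrite normr_lt0.
have A0 : 0 <= 2 * (M + `|a|) by rewrite mulr_ge0 ?addr_ge0.
exists (2 * s ^+ 2 * (n%:R * (2 * (M + `|a|)))).
  by apply: mulr_ge0; rewrite mulr_ge0// sqr_ge0.
move=> y z yM zM.
have S0 (x : E) : s ^+ 2 - \sum_i (x 0 i - a 0 i) ^+ 2 <= s ^+ 2.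
  by rewrite gerBl; apply: sumr_ge0 => i _; rewrite sqr_ge0.
apply: le_trans (sqpos_lip (S0 y) (S0 z) (sqr_ge0 s)) _.
rewrite -[leRHS]mulrA; apply: ler_wpM2l; first by rewrite mulr_ge0// sqr_ge0.
have -> : s ^+ 2 - \sum_i (y 0 i - a 0 i) ^+ 2 - (s ^+ 2 - \sum_i (z 0 i - a 0 i) ^+ 2)
    = \sum_i ((z 0 i - a 0 i) ^+ 2 - (y 0 i - a 0 i) ^+ 2).
  by rewrite sumrB; ring.
apply: le_trans (ler_norm_sum _ _ _) _.
apply: (@le_trans _ _ (\sum_(i < n) (2 * (M + `|a|) * `|y - z|))); last first.
  by rewrite sumr_const card_ord -[leLHS]mulr_natl mulrA.
apply: ler_sum => i _; rewrite subr_sqr normrM mulrC; apply: ler_pM => //.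
  have := coord_le_norm y i; have := coord_le_norm z i; have := coord_le_norm a i.
  move=> aa zz yy.
  have -> : z 0 i - a 0 i + (y 0 i - a 0 i) = z 0 i + y 0 i - (a 0 i + a 0 i) by ring.
  apply: le_trans (ler_normB _ _) _.
  have := ler_normD (z 0 i) (y 0 i); have := ler_normD (a 0 i) (a 0 i).
  lra.
rewrite opprB addrA subrK distrC.
by have := coord_le_norm (y - z) i; rewrite !mxE.
Qed.

End Cutoff.

(** * Energies and the Sobolev inequality on compact sets *)

Section Energy.
Context {R : realType} {n : nat}.
Let E := 'rV[R]_n.
Context {G : set (set E)}.
Let T := g_sigma_algebraType G.
Hypothesis openG : forall U : set E, open U -> <<s G >> U.
Variables (Omega : set E) (mu : {measure set T -> \bar R}).
Hypotheses (Obounded : bounded_set Omega) (Oopen : open Omega).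
Variables (Q : E -> 'M[R]_n) (v : E -> R) (p : R).
Hypothesis p0 : 0 < p.
Hypothesis v0 : forall x, Omega x -> 0 <= v x.
Hypothesis mv : measurable_fun (Omega : set T) (v : T -> R).
Hypothesis v0_le : exists2 c2 : R, 0 < c2 &
  forall x, Omega x -> opnorm (Q x) `^ (p / 2) <= c2 * v x.

(** The p-th power of the norm of L^p_Q. *)
Definition gpow (A : set E) (k : E -> 'cV[R]_n) : \bar R :=
  (\int[mu]_(x in (A : set T)) (enorm (sqrtmx (Q x) *m k x) `^ p)%:E)%E.

Lemma gpow_ge0 A k : (0 <= gpow A k)%E.
Proof. by apply: integral_ge0 => x _; rewrite lee_fin powR_ge0. Qed.

Lemma QHnorm_le A (f : E -> R) k (M : R) : A `<=` Omega -> 0 <= M ->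
  (QHnorm mu Q v p A f k <= M%:E)%E ->
  (wpow mu v p A f <= (M `^ p)%:E)%E /\ (gpow A k <= (M `^ p)%:E)%E.
Proof.
move=> AO M0 H.
have w0 : (0 <= wLnorm mu v p A f)%E by exact: poweR_ge0.
have g0 : (0 <= LQnorm mu Q p A k)%E by exact: poweR_ge0.
split; (apply/poweR_inv_le => //; [|apply: le_trans H]).
- by apply: wpow_ge0 => x /AO; exact: v0.
- by rewrite leeDl.
- exact: gpow_ge0.
- by rewrite leeDr.
Qed.

Lemma le_QHnorm A (f : E -> R) k (M : R) : A `<=` Omega -> 0 <= M ->
  (wpow mu v p A f <= M%:E)%E -> (gpow A k <= M%:E)%E ->
  (QHnorm mu Q v p A f k <= (M `^ p^-1 + M `^ p^-1)%:E)%E.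
Proof.
move=> AO M0 H1 H2.
have MK : (M `^ p^-1) `^ p = M by rewrite -powRrM mulVf ?gt_eqF// powRr1.
rewrite EFinD; apply: leeD; apply/poweR_inv_le; rewrite ?powR_ge0 ?MK//.
  by apply: wpow_ge0 => x /AO; exact: v0.
exact: gpow_ge0.
Qed.

(** The gradient of f eta is eta grad f + c, where each coordinate of c is at
    most |f| L for a Lipschitz constant L of eta on the bounded set Omega.  The
    first term costs a factor sup eta, and |sqrt Q c|^p is at most a multiple of
    opnorm(Q)^(p/2) |f|^p, hence of |f|^p v. *)
Lemma cutoff_energy (a : E) (s : R) : 0 < s -> exists2 C : R, 0 < C &
  forall f : E -> R, loc_lipschitz Omega f ->
  (wpow mu v p Omega (fun y => f y * cutoff a s y)%R <= C%:E * wpow mu v p Omega f)%E /\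
  (gpow Omega (grad (fun y => f y * cutoff a s y)%R) <=
     C%:E * (gpow Omega (grad f) + wpow mu v p Omega f))%E.
Proof.
move=> s0.
have mO : measurable (Omega : set T) by exact: open_measurable_G.
have [M OM] : exists M : R, forall y, Omega y -> `|y| <= M.
  have [M [_ HM]] := Obounded; exists (M + 1) => y Oy.
  by apply: (HM (M + 1)) => //; rewrite ltrDl.
have [L L0 HL] := cutoff_lip a s M.
have [c2 c20 Hc2] := v0_le.
pose C1 := 2 `^ p * (2 `^ p * (s ^+ 4) `^ p).
pose C2 := 2 `^ p * (2 `^ p * (n%:R `^ (p / 2) * c2 * (n%:R * L) `^ p)).
have C10 : 0 < C1 by rewrite /C1 !mulr_gt0 ?powR_gt0 ?exprn_gt0.
have C20 : 0 <= C2 by rewrite /C2 !mulr_ge0 ?powR_ge0 ?(ltW c20).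
have s40 : 0 < (s ^+ 4) `^ p by rewrite powR_gt0 ?exprn_gt0.
pose C := C1 + C2 + (s ^+ 4) `^ p.
have C0 : 0 < C by rewrite /C !ltr_wpDl ?addr_ge0 ?(ltW C10).
exists C => // f fl.
have mf := loc_lipschitz_measurable openG Oopen fl.
have mw := measurable_wpow p mf mv.
have wv0 x : Omega x -> 0 <= `|f x| `^ p * v x.
  by move=> Ox; rewrite mulr_ge0 ?powR_ge0 ?v0.
have W0 : (0 <= wpow mu v p Omega f)%E by exact: wpow_ge0.
split.
  apply: (@le_trans _ _ (C%:E * wpow mu v p Omega f +
      \int[mu]_(x in (Omega : set T)) (cst 0 x : R)%:E)%E); last first.
    by rewrite integral0 adde0.
  apply: lower_integral_le_lin => //.
  - by move=> x Ox; rewrite mulr_ge0 ?powR_ge0 ?v0.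
  - move=> x Ox; rewrite addr0 mulrA ler_wpM2r ?v0// normrM powRM// mulrC.
    rewrite ler_wpM2r ?powR_ge0// (ger0_norm (cutoff_ge0 _ _ _)).
    apply: (@le_trans _ _ ((s ^+ 4) `^ p)).
      by apply: ler_powR2r; rewrite ?cutoff_ge0 ?cutoff_le ?(ltW p0).
    by rewrite lerDr addr_ge0// ltW.
have pt x : Omega x ->
    enorm (sqrtmx (Q x) *m grad (fun y => f y * cutoff a s y) x) `^ p <=
    C1 * enorm (sqrtmx (Q x) *m grad f x) `^ p + C2 * (`|f x| `^ p * v x).
  move=> Ox; set S := sqrtmx (Q x).
  have fc := loc_lipschitz_continuous Oopen fl Ox.
  have db := differentiable_cutoff a s x.
  have bc : {for x, continuous (cutoff a s)} by exact: differentiable_continuous.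
  have coef i := derive_mul_default fc bc (@diff_derivable _ _ _ (cutoff a s) x (delta_mx 0 i : E) db).
  pose c : 'cV[R]_n := grad (fun y => f y * cutoff a s y) x - cutoff a s x *: grad f x.
  have gE : grad (fun y => f y * cutoff a s y) x = cutoff a s x *: grad f x + c.
    by rewrite /c addrC subrK.
  have cc i : `|c i 0| <= `|f x| * L.
    have [ci Hci cE] := coef i.
    rewrite /c !mxE cE addrAC subrr add0r; apply: le_trans Hci _.
    rewrite ler_wpM2l//; apply: (norm_derive_le Oopen Ox L0) => //.
    - by move=> y z Oy Oz; apply: HL; exact: OM.
    - exact: norm_delta_le1.
    - exact: diff_derivable.
  have fL0 : 0 <= `|f x| * L by rewrite mulr_ge0.
  have ec : enorm c <= n%:R * (`|f x| * L) by exact: enorm_le_coord.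
  have Sc : enorm (S *m c) `^ p <=
      n%:R `^ (p / 2) * c2 * (n%:R * L) `^ p * (`|f x| `^ p * v x).
    apply: le_trans (powR_enorm_sqrtmx_le c (ltW p0) (Hc2 x Ox) _) _.
      by rewrite mulr_ge0 ?v0// ltW.
    rewrite -[leRHS]mulrA; apply: ler_wpM2l.
      by rewrite mulr_ge0 ?powR_ge0// ltW.
    rewrite mulrA ler_wpM2r ?v0// -powRM ?mulr_ge0//.
    apply: ler_powR2r; rewrite ?enorm_ge0 ?(ltW p0)//.
    by rewrite mulrAC -mulrA.
  have Sb : enorm (S *m (cutoff a s x *: grad f x)) `^ p <=
      (s ^+ 4) `^ p * enorm (S *m grad f x) `^ p.
    rewrite -scalemxAr enormZ powRM ?enorm_ge0// ler_wpM2r ?powR_ge0//.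
    rewrite (ger0_norm (cutoff_ge0 _ _ _)).
    by apply: ler_powR2r; rewrite ?cutoff_ge0 ?cutoff_le ?(ltW p0).
  rewrite gE mulmxDr.
  apply: (@le_trans _ _ ((2 * (enorm (S *m (cutoff a s x *: grad f x)) + enorm (S *m c))) `^ p)).
    by apply: ler_powR2r; rewrite ?enorm_ge0 ?enormD_le ?(ltW p0).
  rewrite powRM ?addr_ge0 ?enorm_ge0// /C1 /C2 -!(mulrA (2 `^ p)) -mulrDr.
  rewrite ler_wpM2l ?powR_ge0//.
  apply: le_trans (powRD_le p0 (enorm_ge0 _) (enorm_ge0 _)) _.
  by rewrite -mulrDr ler_wpM2l ?powR_ge0//; apply: lerD.
apply: (@le_trans _ _ (C1%:E * gpow Omega (grad f) + C2%:E * wpow mu v p Omega f)%E).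
  have -> : (C2%:E * wpow mu v p Omega f =
     \int[mu]_(x in (Omega : set T)) (C2 * (`|f x| `^ p * v x))%:E)%E.
    under [RHS]eq_integral do rewrite EFinM.
    by rewrite ge0_integralZl_EFin//; exact/measurable_EFinP.
  apply: lower_integral_le_lin => //.
  - by move=> x Ox; rewrite powR_ge0.
  - by move=> x Ox; rewrite powR_ge0.
  - by move=> x Ox; apply: mulr_ge0 => //; exact: wv0.
  - exact: measurable_funM.
rewrite (ge0_muleDr C%:E (gpow_ge0 Omega (grad f)) W0); apply: leeD.
  apply: lee_wpmul2r; first exact: gpow_ge0.
  by rewrite lee_fin /C -addrA lerDl addr_ge0// ltW.
by apply: lee_wpmul2r => //; rewrite lee_fin /C addrAC lerDr addr_ge0// ltW.
Qed.

End Energy.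

Lemma compact_finite_cover {R : realType} {n : nat} (K : set 'rV[R]_n)
    (O : 'rV[R]_n -> set 'rV[R]_n) :
  compact K -> (forall x, K x -> open (O x) /\ O x x) ->
  exists s : seq 'rV[R]_n, (forall x, x \in s -> K x) /\
    forall y, K y -> exists2 x, x \in s & O x y.
Proof.
rewrite compact_cover => cK KO.
have [|x Kx|F FK KF] := cK _ K O; first by move=> x /KO[].
  by exists x => //; case: (KO x Kx).
exists (finmap.enum_fset F); split=> [x xF|y /KF[x xF Oxy]]; first by apply: set_mem; exact: FK.
by exists x.
Qed.

Section SobolevOnCompact.
Context {R : realType} {n : nat}.
Let E := 'rV[R]_n.
Context {G : set (set E)}.
Let T := g_sigma_algebraType G.
Hypothesis openG : forall U : set E, open U -> <<s G >> U.
Variables (Omega : set E) (mu : {measure set T -> \bar R}).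
Hypotheses (Obounded : bounded_set Omega) (Oopen : open Omega).
Variables (Q : E -> 'M[R]_n) (v : E -> R) (p : R).
Hypothesis p0 : 0 < p.
Hypothesis v0 : forall x, Omega x -> 0 <= v x.
Hypothesis mv : measurable_fun (Omega : set T) (v : T -> R).
Hypothesis v0_le : exists2 c2 : R, 0 < c2 &
  forall x, Omega x -> opnorm (Q x) `^ (p / 2) <= c2 * v x.
Local Notation wp := (wpow mu v).
Local Notation gp := (gpow mu Q p).

Lemma cutoff_Lip0 (B : set E) (f : E -> R) (a : E) (s : R) :
  B `<=` Omega -> 0 < s -> closed_ball a s `<=` B -> loc_lipschitz Omega f ->
  Lip0 B (fun y => f y * cutoff a s y).
Proof.
move=> BO s0 aB fl.
have suppS : closure [set x | f x * cutoff a s x != 0] `<=` closed_ball a s.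
  have /closure_id -> : closed (closed_ball a s) by exact: closed_closure.
  apply: closure_subset => y /=.
  rewrite mulf_eq0 negb_or => /andP[_ /(cutoff_neq0 s0)].
  by rewrite closed_ballE//= /closed_ball_/= distrC.
have [M OM] : exists M : R, forall y, Omega y -> `|y| <= M.
  have [M [_ HM]] := Obounded; exists (M + 1) => y Oy.
  by apply: (HM (M + 1)) => //; rewrite ltrDl.
have [L L0 HL] := cutoff_lip a s M.
split.
- apply: (loc_lipschitz_mul (L := L) (B := s ^+ 4)) => //.
  + by rewrite (_ : s ^+ 4 = (s ^+ 2) ^+ 2) ?sqr_ge0// -exprM.
  + exact: loc_lipschitz_sub fl.
  + by move=> y z /BO Oy /BO Oz; apply: HL; exact: OM.
  + by move=> y By; rewrite ger0_norm ?cutoff_ge0// cutoff_le.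
- apply: bounded_closed_compact; last exact: closed_closure.
  exists M; split; first exact: num_real.
  move=> M' MM' y /suppS /aB /BO /OM /le_trans; apply; exact: ltW.
- exact: subset_trans aB.
Qed.

(** Near a point, f is controlled by its product with a cutoff supported in a
    small ball, to which the Sobolev inequality for compactly supported
    functions applies. *)
Lemma sobolev_near (B : set E) (a : E) (q C M : R) :
  open B -> B `<=` Omega -> B a -> 0 < q -> 0 < C -> 0 <= M ->
  (forall f, Lip0 B f ->
    (wLnorm mu v q B f <= C%:E * QHnorm mu Q v p Omega f (grad f))%E) ->
  exists2 N : set E, [/\ open N, N a & N `<=` Omega] &
  exists2 K : R, 0 <= K & forall f, loc_lipschitz Omega f ->
    (wp p Omega f <= M%:E)%E -> (gp Omega (grad f) <= M%:E)%E ->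
    (wp q N f <= K%:E)%E.
Proof.
move=> oB BO Ba q0 C0 M0 HC.
have [e /= e0 aeB] : exists2 e : R, 0 < e & ball a e `<=` B.
  by apply/nbhs_ballP; exact: open_nbhs_nbhs.
have s0 : 0 < e / 2 by rewrite divr_gt0.
set s := e / 2 in s0.
have sB : closed_ball a s `<=` B.
  apply: subset_trans aeB => y; rewrite closed_ballE// /closed_ball_/= => ay.
  rewrite mx_norm_ball /ball_/=; apply: le_lt_trans ay _.
  by rewrite /s ltr_pdivrMr// ltr_pMr// ltr1n.
have [K K0 HK] := cutoff_energy openG mu Obounded Oopen p0 v0 mv v0_le a s0.
(* N is the set where the cutoff exceeds half of its maximum s^4 *)
pose c := s ^+ 4 / 2.
have s4 : 0 < s ^+ 4 by rewrite exprn_gt0.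
have c0 : 0 < c by rewrite divr_gt0.
pose N : set E := [set y | c < cutoff a s y].
have cc : continuous (cutoff a s).
  by move=> y; apply: differentiable_continuous; exact: differentiable_cutoff.
have oN : open N.
  have -> : N = cutoff a s @^-1` [set t | c < t] by [].
  by apply: open_comp => [y _|]; [exact: cc|exact: open_gt].
have Na : N a.
  by rewrite /N/= cutoff_center /c ltr_pdivrMr// ltr_pMr// ltr1n.
have NB : N `<=` B.
  move=> y /= cy; apply: sB; rewrite closed_ballE// /closed_ball_/= distrC.
  by apply: cutoff_neq0 => //; rewrite gt_eqF// (lt_trans c0).
have NO : N `<=` Omega by exact: subset_trans BO.
exists N => //.
pose K1 := K * (M + M).
have K10 : 0 <= K1 by rewrite mulr_ge0 ?addr_ge0// ltW.
pose K2 := (C * (K1 `^ p^-1 + K1 `^ p^-1)) `^ q.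
have cq0 : 0 < c^-1 `^ q by rewrite powR_gt0 ?invr_gt0.
exists (c^-1 `^ q * K2); first by rewrite mulr_ge0 ?powR_ge0.
move=> f fl fM gM; have [H1 H2] := HK f fl.
have mO : measurable (Omega : set T) by exact: open_measurable_G.
have mN : measurable (N : set T) by exact: open_measurable_G.
have MM : (M%:E <= (M + M)%:E)%E by rewrite lee_fin lerDl.
have KK : (K%:E * (M + M)%:E = K1%:E)%E by [].
have H3 : (wp p Omega (fun y => f y * cutoff a s y)%R <= K1%:E)%E.
  apply: le_trans H1 _; rewrite -KK; apply: lee_wpmul2l; first by rewrite lee_fin ltW.
  exact: le_trans fM MM.
have H4 : (gp Omega (grad (fun y => f y * cutoff a s y)%R) <= K1%:E)%E.
  apply: le_trans H2 _; rewrite -KK; apply: lee_wpmul2l; first by rewrite lee_fin ltW.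
  by rewrite EFinD; exact: leeD.
have H5 := HC _ (cutoff_Lip0 BO s0 sB fl).
have H6 := le_QHnorm p0 v0 (@subset_refl _ Omega) K10 H3 H4.
have H7 : (wp q B (fun y => f y * cutoff a s y)%R <= K2%:E)%E.
  apply/poweR_inv_le => //.
  - by apply: wpow_ge0 => x /BO; exact: v0.
  - by rewrite mulr_ge0 ?addr_ge0 ?powR_ge0// ltW.
  - apply: le_trans H5 _; rewrite EFinM; apply: lee_wpmul2l => //.
    by rewrite lee_fin ltW.
apply: (@le_trans _ _ ((c^-1 `^ q)%:E * wp q N (fun y => f y * cutoff a s y)%R +
      \int[mu]_(x in (N : set T)) (cst 0 x : R)%:E)%E).
  apply: lower_integral_le_lin => //.
  - by move=> x Nx; rewrite mulr_ge0 ?powR_ge0 ?v0//; exact: NO.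
  - by move=> x Nx; rewrite mulr_ge0 ?powR_ge0 ?v0//; exact: NO.
  - move=> x Nx; rewrite addr0 mulrA ler_wpM2r ?v0//; first exact: NO.
    rewrite -powRM ?invr_ge0 ?(ltW c0)//.
    apply: ler_powR2r; rewrite ?(ltW q0)// ler_pdivlMl// normrM mulrC.
    rewrite ler_wpM2l// (ger0_norm (cutoff_ge0 _ _ _)); exact: ltW.
rewrite integral0 adde0 EFinM; apply: lee_wpmul2l; first by rewrite lee_fin ltW.
by apply: le_trans H7; apply: wpow_subset => // x /BO; exact: v0.
Qed.

Lemma sobolev_on_compact (rho : E -> E -> R) (sigma : R) (K : set E) (M : R) :
  quasimetric Omega rho -> qball_conditions Omega rho ->
  loc_sobolev Omega rho mu Q v p sigma -> 0 < sigma -> 0 <= M ->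
  compact K -> K `<=` Omega ->
  exists2 M' : R, 0 <= M' & forall f, loc_lipschitz Omega f ->
    (wp p Omega f <= M%:E)%E -> (gp Omega (grad f) <= M%:E)%E ->
    (wp (p * sigma) K f <= M'%:E)%E.
Proof.
move=> [kappa _ qm] [balls_open _] sob s0 M0 cK KO.
have [d2 d20 Hd2] := sob K cK KO.
have r0 : 0 < d2 / 2 < d2 by rewrite divr_gt0//= ltr_pdivrMr// ltr_pMr// ltr1n.
have near a : K a -> exists NK : set E * R, [/\ open NK.1, NK.1 a, NK.1 `<=` Omega, 0 <= NK.2 &
    forall f, loc_lipschitz Omega f ->
    (wp p Omega f <= M%:E)%E -> (gp Omega (grad f) <= M%:E)%E ->
    (wp (p * sigma) NK.1 f <= NK.2%:E)%E].
  move=> Ka; have [C C0 HC] := Hd2 (d2 / 2) a r0 Ka.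
  have Oa := KO _ Ka.
  have BO : qball Omega rho a (d2 / 2) `<=` Omega by move=> y [].
  have Ba : qball Omega rho a (d2 / 2) a.
    split => //; have [_ [_ aa] _ _] := qm a a a Oa Oa Oa.
    by rewrite aa// divr_gt0.
  have ps0 : 0 < p * sigma by rewrite mulr_gt0.
  have [N [oN Na NO] [K' K'0 HK']] := @sobolev_near (qball Omega rho a (d2 / 2)) a
    (p * sigma) C M (balls_open _ _ Oa) BO Ba ps0 C0 M0 HC.
  by exists (N, K').
have near' a : exists NK : set E * R, K a -> [/\ open NK.1, NK.1 a, NK.1 `<=` Omega, 0 <= NK.2 &
    forall f, loc_lipschitz Omega f ->
    (wp p Omega f <= M%:E)%E -> (gp Omega (grad f) <= M%:E)%E ->
    (wp (p * sigma) NK.1 f <= NK.2%:E)%E].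
  have [/near[NK H]|nKa] := pselect (K a); first by exists NK.
  by exists (set0, 0) => /nKa.
have {near near'} [NK HNK] := choice near'.
have [x Kx|s [sK Ks]] := @compact_finite_cover _ _ K (fun a => (NK a).1) cK.
  by case: (HNK x Kx).
exists (\sum_(a <- s) Num.max 0 (NK a).2).
  by apply: sumr_ge0 => a _; rewrite le_max lexx.
move=> f fl fM gM.
have mO : measurable (Omega : set T) by exact: open_measurable_G.
have mf := loc_lipschitz_measurable openG Oopen fl.
apply: le_trans (wpow_cover mu (p * sigma) mO mv v0 mf _ _ Ks) _.
- by move=> a /sK /HNK[oN _ _ _ _]; exact: open_measurable_G.
- by move=> a /sK /HNK[].
rewrite -sumEFin big_seq [leRHS]big_seq; apply: lee_sum => a /sK Ka.
have [_ _ _ _ H] := HNK a Ka.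
apply: le_trans (H f fl fM gM) _; by rewrite lee_fin le_max lexx orbT.
Qed.

End SobolevOnCompact.

(** * Covers by quasimetric balls *)

Lemma seq_lower_bound {R : realType} {I : eqType} (s : seq I) (d : I -> R) :
  (forall i, i \in s -> 0 < d i) -> exists2 e, 0 < e & forall i, i \in s -> e <= d i.
Proof.
elim: s => [|i s IH] H; first by exists 1.
have [|e e0 He] := IH; first by move=> j js; apply: H; rewrite inE js orbT.
exists (Num.min e (d i)) => [|j].
  by rewrite lt_min e0 H// mem_head.
by rewrite inE => /predU1P[->|/He]; rewrite ge_min ?lexx ?orbT// => ->.
Qed.

Lemma greedy_independent {I : eqType} (r : rel I) (s : seq I) :
  exists s' : seq I, [/\ {subset s' <= s}, pairwise (fun x y => ~~ r x y) s' &
    forall x, x \in s -> exists2 y, y \in s' & (x == y) || r x y].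
Proof.
elim: s => [|x s [s' [s's ps' cs']]]; first by exists [::].
have [xs'|] := boolP (all (fun y => ~~ r x y) s').
  exists (x :: s'); split => /=; last 1 first.
  - move=> y; rewrite inE => /predU1P[->|/cs'[z zs' yz]].
      by exists x; rewrite ?mem_head// eqxx.
    by exists z => //; rewrite inE zs' orbT.
  - by move=> y; rewrite !inE => /predU1P[->|/s's ->]; rewrite ?eqxx ?orbT.
  - by rewrite xs' ps'.
move=> /allPn[y ys' /negPn xy]; exists s'; split => //.
  by move=> z /s's zs; rewrite inE zs orbT.
move=> z; rewrite inE => /predU1P[->|/cs'//].
by exists y => //; rewrite xy orbT.
Qed.

Section QuasimetricCovers.
Context {R : realType} {n : nat}.
Let E := 'rV[R]_n.
Variables (Omega : set E) (rho : E -> E -> R).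
Hypothesis rho_qm : quasimetric Omega rho.
Hypothesis rho_balls : qball_conditions Omega rho.
Local Notation B := (qball Omega rho).

Lemma qball_center x r : Omega x -> 0 < r -> B x r x.
Proof.
move=> Ox r0; split => //; have [kappa _ qm] := rho_qm.
by have [_ [_ ->]] := qm x x x Ox Ox Ox.
Qed.

Lemma disjoint_ball_count (x0 : E) (t r N : R) (s : seq E) :
  (forall (m : nat) (c : 'I_m -> E), (forall i, B x0 r (c i)) ->
    trivIset [set: 'I_m] (fun i => B (c i) t) -> m%:R <= N) ->
  (forall x, x \in s -> B x0 r x) ->
  pairwise (fun x y => ~~ `[< (B x t `&` B y t) !=set0 >]) s ->
  (size s)%:R <= N.
Proof.
move=> Hd sB ps.
apply: (Hd (size s) (fun i => nth x0 s i)).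
  by move=> i; apply: sB; exact: mem_nth.
have H (i j : 'I_(size s)) : (i < j)%N ->
    (B (nth x0 s i) t `&` B (nth x0 s j) t) !=set0 -> False.
  move=> ij mij; have := pairwiseP x0 ps i j (ltn_ord i) (ltn_ord j) ij.
  by move=> /negP; apply; apply/asboolP.
move=> i j _ _ ij; apply: ord_inj; apply/eqP; rewrite eqn_leq (leqNgt i) (leqNgt j).
apply/andP; split; apply/negP => lt.
  by apply: (H j i lt); rewrite setIC.
exact: (H i j lt).
Qed.

(** A maximal disjoint family among finitely many small balls covering K: its
    enlargements still cover K, and the disjoint small balls around the centres
    whose large balls share a point are counted by the doubling condition. *)
Lemma bounded_overlap_cover (c0 : R) (K : set E) :
  1 <= c0 -> loc_geom_doubling Omega rho -> compact K -> K `<=` Omega ->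
  exists2 N : R, 0 < N & forall e : R, 0 < e -> exists r : R, exists s : seq E,
    [/\ 0 < r < e, forall x, x \in s -> K x,
        forall y, K y -> exists2 x, x \in s & B x r y &
        forall y, Omega y -> \sum_(x <- s) (\1_(B x (c0 * r)) y : R) <= N].
Proof.
move=> c01 [C [Cpos HC]] cK KO.
have [kappa k1 qm] := rho_qm.
have [delta d0 Hd] := HC K cK KO.
have k0 : 0 < kappa by exact: lt_le_trans k1.
have c00 : 0 < c0 by exact: lt_le_trans c01.
(* A ball of radius t that meets B(z, t) lies in B(z, lam t).  If B(x, c0 lam t)
   and B(x', c0 lam t) have a common point, then x' lies in B(x, th t). *)
pose lam := kappa + 2 * kappa ^+ 2.
have lam1 : 1 <= lam.
  by rewrite /lam; have := sqr_ge0 kappa; move: k1; lra.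
have lam0 : 0 < lam by exact: lt_le_trans lam1.
pose th := 2 * kappa * c0 * lam.
have th1 : 1 <= th.
  have kc : 1 <= kappa * c0 by rewrite -[1]mulr1; apply: ler_pM.
  have kcl : 1 <= kappa * c0 * lam by rewrite -[1]mulr1; apply: ler_pM.
  by rewrite /th -!mulrA !(mulrA kappa); move: kcl; lra.
have th0 : 0 < th by exact: lt_le_trans th1.
exists (C th); first exact: Cpos.
move=> e e0.
pose t := Num.min (e / (2 * lam)) (delta / (2 * th)).
have t0 : 0 < t by rewrite lt_min !divr_gt0// mulr_gt0.
have te : lam * t < e.
  have : t <= e / (2 * lam) by rewrite ge_min lexx.
  rewrite ler_pdivlMr ?mulr_gt0// => H.
  have : 0 < lam * t by rewrite mulr_gt0.
  by move: H; rewrite mulrC -mulrA; lra.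
have td : th * t < delta.
  have : t <= delta / (2 * th) by rewrite ge_min lexx orbT.
  rewrite ler_pdivlMr ?mulr_gt0// => H.
  have : 0 < th * t by rewrite mulr_gt0.
  by move: H; rewrite mulrC -mulrA; lra.
have r0 : 0 < lam * t by rewrite mulr_gt0.
have [x Kx|s0 [s0K Ks0]] := @compact_finite_cover _ _ K (fun x => B x t) cK.
  by have Ox := KO _ Kx; split; [exact: rho_balls.1|exact: qball_center].
pose meets x y := `[< (B x t `&` B y t) !=set0 >].
have [s [ss0 ps cs]] := greedy_independent meets s0.
have sK x : x \in s -> K x by move=> /ss0/s0K.
exists (lam * t), s; split => //.
- by rewrite r0.
- move=> y Ky; have Oy := KO _ Ky; have [x xs0 [_ xy]] := Ks0 y Ky.
  have Ox := KO _ (s0K _ xs0).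
  have [z zs /orP[/eqP xz|/asboolP[w [[Ow xw] [_ zw]]]]] := cs x xs0.
    exists z => //; split => //; rewrite -xz; apply: lt_le_trans xy _.
    by rewrite ler_peMl// ltW.
  have Oz := KO _ (sK _ zs).
  exists z => //; split => //.
  have [_ _ _ t1] := qm z x w Oz Ox Ow.
  have [_ _ wx _] := qm w x w Ow Ox Ow.
  have [_ _ _ t2] := qm z y x Oz Oy Ox.
  apply: le_lt_trans t2 _.
  have zx : rho z x < kappa * (2 * t).
    by apply: le_lt_trans t1 _; rewrite ltr_pM2l// wx; move: xw zw; lra.
  have -> : lam * t = kappa * (kappa * (2 * t) + t) by rewrite /lam; ring.
  by rewrite ltr_pM2l// ltrD.
move=> y Oy.
pose s' := [seq x <- s | y \in B x (c0 * (lam * t))].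
have -> : \sum_(x <- s) (\1_(B x (c0 * (lam * t))) y : R) = (size s')%:R.
  rewrite /s' size_filter -sum1_count natr_sum [RHS]big_mkcond /=.
  apply: eq_bigr => x _; rewrite indicE; by case: ifP.
case E0 : s' => [|x0 s1]; first by rewrite ltW// Cpos.
rewrite -E0.
have x0s' : x0 \in s' by rewrite E0 mem_head.
have s'P x : x \in s' -> K x /\ rho x y < c0 * (lam * t).
  by rewrite mem_filter => /andP[/set_mem[_ ?] /sK].
have [Kx0 x0y] := s'P _ x0s'; have Ox0 := KO _ Kx0.
have thE : th * t / t = th by rewrite mulfK// gt_eqF.
rewrite -[in leRHS]thE.
apply: (@disjoint_ball_count x0 t (th * t)).
- by apply: (Hd t (th * t) x0 t0 _ td Kx0); rewrite ler_peMl// ltW.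
- move=> x /s'P[Kx xy]; have Ox := KO _ Kx; split => //.
  have [_ _ _ tr] := qm x0 x y Ox0 Ox Oy.
  have [_ _ yx _] := qm y x y Oy Ox Oy.
  apply: le_lt_trans tr _; rewrite yx.
  have -> : th * t = kappa * (c0 * (lam * t) + c0 * (lam * t)) by rewrite /th; ring.
  by rewrite ltr_pM2l// ltrD.
- exact: pairwise_filter.
Qed.

End QuasimetricCovers.

(** * The Poincare inequality and Cauchy subsequences *)

Section PoincareCompactness.
Context {R : realType} {n : nat}.
Let E := 'rV[R]_n.
Context {G : set (set E)}.
Let T := g_sigma_algebraType G.
Hypothesis openG : forall U : set E, open U -> <<s G >> U.
Variables (Omega : set E) (mu : {measure set T -> \bar R}).
Hypotheses (Obounded : bounded_set Omega) (Oopen : open Omega).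
Variables (Q : E -> 'M[R]_n) (v : E -> R) (p : R).
Hypothesis p1 : 1 <= p.
Hypothesis v0 : forall x, Omega x -> 0 <= v x.
Hypothesis v_loc : locally_integrable_on Omega mu v.
Variable (rho : E -> E -> R).
Hypothesis rho_qm : quasimetric Omega rho.
Hypothesis rho_balls : qball_conditions Omega rho.
Local Notation B := (qball Omega rho).
Local Notation wp := (wpow mu v).
Local Notation gp := (gpow mu Q p).

Let mv : measurable_fun (Omega : set T) (v : T -> R) := v_loc.1.
Let p0 : 0 < p := lt_le_trans ltr01 p1.

Lemma weight_compact_lty (A : set E) :
  compact A -> A `<=` Omega -> (\int[mu]_(x in (A : set T)) (v x)%:E < +oo)%E.
Proof.
move=> cA AO; apply: le_lt_trans (v_loc.2 A cA AO).
apply: ge0_le_lower_integral => x /AO Ox; first by rewrite lee_fin v0.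
by rewrite lee_fin ler_norm.
Qed.

(** The quasi-triangle inequality turns the radii of finitely many centres into
    one radius valid on all of K; balls of smaller radius lie in compact subsets
    of Omega, on which v is integrable. *)
Lemma small_ball_weight_lty (K : set E) : compact K -> K `<=` Omega ->
  exists2 d : R, 0 < d & forall x r, K x -> r < d ->
    (\int[mu]_(y in (B x r : set T)) (v y)%:E < +oo)%E.
Proof.
move=> cK KO; have [kappa k1 qm] := rho_qm.
have k0 : 0 < kappa by exact: lt_le_trans k1.
have /choice[da Hda] a : exists d : R, K a -> 0 < d /\
    forall r : R, 0 < r < d -> closure (B a r) `<=` Omega.
  have [Ka|nKa] := pselect (K a); last by exists 0 => /nKa.
  by have [d d0 Hd] := rho_balls.2 a (KO _ Ka); exists d.
have dk a : K a -> 0 < da a / (4 * kappa).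
  by move=> /Hda[d0 _]; rewrite divr_gt0// mulr_gt0.
have [x Kx|s [sK Ks]] := @compact_finite_cover _ _ K
    (fun x => B x (da x / (4 * kappa))) cK.
  have Ox := KO _ Kx; split; first exact: rho_balls.1.
  by apply: qball_center => //; exact: dk.
have [|d d0 Hd] := @seq_lower_bound R _ s (fun a => da a / (4 * kappa)).
  by move=> a /sK; exact: dk.
exists d => // x r Kx rd; have [a sa [Ox ax]] := Ks x Kx.
have Ka := sK _ sa; have Oa := KO _ Ka; have [da0 Hcl] := Hda a Ka.
have half : 0 < da a / 2 < da a by rewrite divr_gt0//= ltr_pdivrMr// ltr_pMr// ltr1n.
have sub : B x r `<=` closure (B a (da a / 2)).
  apply: subset_trans (@subset_closure _ _) => y [Oy xy]; split => //.
  have [_ _ _ tr] := qm a y x Oa Oy Ox; apply: le_lt_trans tr _.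
  have -> : da a / 2 = kappa * (da a / (4 * kappa) + da a / (4 * kappa)).
    by field; rewrite gt_eqF.
  rewrite ltr_pM2l// ltrD//; apply: lt_le_trans (Hd _ sa).
  exact: lt_trans rd.
apply: (@le_lt_trans _ _ (\int[mu]_(y in (closure (B a (da a / 2)) : set T)) (v y)%:E)%E).
  apply: ge0_subset_lower_integral => // y /(Hcl _ half) Oy.
  by rewrite lee_fin v0.
apply: weight_compact_lty; last exact: Hcl half.
apply: bounded_closed_compact; last exact: closed_closure.
have [M [Mr HM]] := Obounded; exists M; split => // M' MM' y /(Hcl _ half).
exact: HM.
Qed.

(** Since |f| <= 1 + |f|^p, the bound on the averages depends only on A and M. *)
Lemma wmean_bounded (A : set E) (M : R) : measurable (A : set T) ->
  A `<=` Omega -> (\int[mu]_(y in (A : set T)) (v y)%:E < +oo)%E -> 0 <= M ->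
  exists M' : R, forall f : E -> R, measurable_fun (Omega : set T) (f : T -> R) ->
    (wp p A f <= M%:E)%E -> `|wmean mu v A f| <= M'.
Proof.
move=> mA AO vA M0.
have mvA : measurable_fun (A : set T) (v : T -> R).
  apply: measurable_funS mv => //; exact: open_measurable_G.
have vA0 : (0 <= \int[mu]_(y in (A : set T)) (v y)%:E)%E.
  by apply: integral_ge0 => x /AO Ox; rewrite lee_fin v0.
pose V := fine (\int[mu]_(y in (A : set T)) (v y)%:E)%E.
have VE : (\int[mu]_(y in (A : set T)) (v y)%:E = V%:E)%E.
  by rewrite fineK// ge0_fin_numE.
exists ((M + V) * `|(\int[mu]_(x in (A : set T)) v x)^-1|) => f mf fM.
rewrite /wmean normrM ler_wpM2r// /Rintegral.
have mfA : measurable_fun (A : set T) (f : T -> R).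
  apply: measurable_funS mf => //; exact: open_measurable_G.
have mfv : measurable_fun (A : set T) (fun x => (f x * v x)%:E : \bar R).
  by apply/measurable_EFinP; exact: measurable_funM.
have H : (`|\int[mu]_(x in (A : set T)) (f x * v x)%:E| <= (M + V)%:E)%E.
  apply: le_trans (le_abse_integral mu mA mfv) _.
  apply: (@le_trans _ _ (1%:E * wp p A f + \int[mu]_(y in (A : set T)) (v y)%:E)%E); last first.
    by rewrite mul1e VE EFinD leeD2r.
  under eq_integral do rewrite abse_EFin.
  apply: lower_integral_le_lin => //.
  - by move=> x /AO Ox; rewrite mulr_ge0 ?powR_ge0 ?v0.
  - by move=> x /AO; exact: v0.
  move=> x /AO Ox; rewrite normrM (ger0_norm (v0 Ox)) mul1r.
  rewrite -[X in _ + X]mul1r -mulrDl ler_wpM2r ?v0//.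
  have [f1|f1] := leP `|f x| 1; first by rewrite ler_wpDl ?powR_ge0.
  by rewrite ler_wpDr//; apply: le1r_powR => //; exact: ltW.
rewrite -lee_fin; apply: le_trans H.
by case: (integral _ _ _) => [x||] //=; rewrite ?normr0 ?leey.
Qed.

(** The Poincare inequality raised to the power p, which can be summed over
    balls. *)
Lemma ball_poincare (A A' : set E) (f : E -> R) (e : R) :
  A `<=` Omega -> A' `<=` Omega -> 0 <= e ->
  (wpow mu v p A' f < +oo)%E -> (gp A' (grad f) < +oo)%E ->
  (wLnorm mu v p A (fun y => f y - wmean mu v A f)%R <=
     e%:E * QHnorm mu Q v p A' f (grad f))%E ->
  (wp p A (fun y => f y - wmean mu v A f)%R <=
     (e `^ p * 2 `^ p)%:E * (wp p A' f + gp A' (grad f)))%E.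
Proof.
move=> AO A'O e0 wf gf H.
have w0 : (0 <= wp p A' f)%E by apply: wpow_ge0 => x /A'O; exact: v0.
have g0 : (0 <= gp A' (grad f))%E by exact: gpow_ge0.
have {}H : ((wp p A (fun y => f y - wmean mu v A f)%R `^ p^-1)%E <=
    e%:E * ((wp p A' f `^ p^-1)%E + (gp A' (grad f) `^ p^-1)%E))%E := H.
have wE : wp p A' f = (fine (wp p A' f))%:E by rewrite fineK// ge0_fin_numE.
have gE : gp A' (grad f) = (fine (gp A' (grad f)))%:E by rewrite fineK// ge0_fin_numE.
rewrite wE gE !poweR_EFin -EFinD -EFinM in H *.
have a0 : 0 <= fine (wp p A' f) by exact: fine_ge0.
have b0 : 0 <= fine (gp A' (grad f)) by exact: fine_ge0.
move: a0 b0 H {wE gE}.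
move: (fine (wp p A' f)) (fine (gp A' (grad f))) => a b a0 b0 H.
apply: le_trans ((poweR_inv_le _ p0 _).1 H) _.
- by apply: wpow_ge0 => x /AO; exact: v0.
- by rewrite mulr_ge0 ?addr_ge0 ?powR_ge0.
rewrite -EFinD -EFinM lee_fin powRM ?addr_ge0 ?powR_ge0// -mulrA ler_wpM2l ?powR_ge0//.
apply: le_trans (powRD_le p0 (powR_ge0 _ _) (powR_ge0 _ _)) _.
have pK (t : R) : 0 <= t -> (t `^ p^-1) `^ p = t.
  by move=> t0; rewrite -powRrM mulVf ?gt_eqF// powRr1.
by rewrite !pK.
Qed.

End PoincareCompactness.

Section PoincareCauchy.
Context {R : realType} {n : nat}.
Let E := 'rV[R]_n.
Context {G : set (set E)}.
Let T := g_sigma_algebraType G.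
Hypothesis openG : forall U : set E, open U -> <<s G >> U.
Variables (Omega : set E) (mu : {measure set T -> \bar R}).
Hypotheses (Obounded : bounded_set Omega) (Oopen : open Omega).
Variables (Q : E -> 'M[R]_n) (v : E -> R) (p : R).
Hypothesis p1 : 1 <= p.
Hypothesis v0 : forall x, Omega x -> 0 <= v x.
Hypothesis v_loc : locally_integrable_on Omega mu v.
Variable (rho : E -> E -> R).
Hypothesis rho_qm : quasimetric Omega rho.
Hypothesis rho_balls : qball_conditions Omega rho.
Local Notation B := (qball Omega rho).
Local Notation wp := (wpow mu v).
Local Notation gp := (gpow mu Q p).

Let mv : measurable_fun (Omega : set T) (v : T -> R) := v_loc.1.
Let p0 : 0 < p := lt_le_trans ltr01 p1.
Let mO : measurable (Omega : set T).
Proof. exact: open_measurable_G. Qed.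

Lemma ball_sub x r : B x r `<=` Omega.
Proof. by move=> y []. Qed.

(** f - g = (f - a) - ((g - b) - (a - b)), with a and b the averages of f and g
    in the application. *)
Lemma wpow_split_mean (A : set E) (f g : E -> R) (a b : R) (d : R) :
  measurable (A : set T) -> A `<=` Omega ->
  measurable_fun (A : set T) (f : T -> R) -> measurable_fun (A : set T) (g : T -> R) ->
  `|a - b| <= d ->
  (wp p A (f \- g)%R <= (2 `^ p)%:E * wp p A (fun y => f y - a)%R +
     ((2 `^ p * 2 `^ p)%:E * wp p A (fun y => g y - b)%R +
     (2 `^ p * 2 `^ p * d `^ p)%:E * \int[mu]_(y in (A : set T)) (v y)%:E))%E.
Proof.
move=> mA AO mf mg abd.
have vA x : A x -> 0 <= v x by move=> /AO; exact: v0.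
have mvA : measurable_fun (A : set T) (v : T -> R) by apply: measurable_funS mv.
have mfa : measurable_fun (A : set T) ((fun y => f y - a) : T -> R).
  by apply: measurable_funB => //; exact: measurable_cst.
have mgb : measurable_fun (A : set T) ((fun y => g y - b) : T -> R).
  by apply: measurable_funB => //; exact: measurable_cst.
have mab : measurable_fun (A : set T) (cst (a - b) : T -> R) by exact: measurable_cst.
pose h y := `|g y - b| + `|a - b|.
have mh : measurable_fun (A : set T) (h : T -> R).
  by apply: measurable_funD; apply: measurableT_comp.
have H1 : (wp p A (f \- g)%R <= (2 `^ p)%:E * (wp p A (fun y => f y - a)%R + wp p A h))%E.
  apply: wpow_le_add => // x Ax.
  have -> : (f \- g) x = (f x - a) - (g x - b - (a - b)) by rewrite /=; ring.
  apply: le_trans (ler_normB _ _) _; rewrite lerD2l.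
  have -> : `|h x| = `|g x - b| + `|a - b| by rewrite ger0_norm// /h addr_ge0.
  exact: ler_normB.
have H2 : (wp p A h <= (2 `^ p)%:E * (wp p A (fun y => g y - b)%R + wp p A (cst (a - b)%R)))%E.
  by apply: wpow_le_add => // x Ax; rewrite ger0_norm ?addr_ge0.
have H3 : (wp p A (cst (a - b)%R) <= (d `^ p)%:E * \int[mu]_(y in (A : set T)) (v y)%:E)%E.
  rewrite -ge0_integralZl_EFin ?powR_ge0//; last exact/measurable_EFinP.
    apply: ge0_le_lower_integral => x Ax.
      by rewrite lee_fin mulr_ge0 ?powR_ge0 ?vA.
    rewrite -EFinM lee_fin ler_wpM2r ?vA//.
    by apply: ler_powR2r => //; exact: ltW.
have t0 : (0 <= (2 `^ p : R)%:E)%E by rewrite lee_fin powR_ge0.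
have I0 : (0 <= \int[mu]_(y in (A : set T)) (v y)%:E)%E.
  by apply: integral_ge0 => x Ax; rewrite lee_fin vA.
have w0 k : (0 <= wp p A k)%E by exact: wpow_ge0.
apply: le_trans H1 _; rewrite ge0_muleDr//; apply: leeD2l.
apply: le_trans (lee_wpmul2l t0 H2) _.
rewrite muleA -EFinM ge0_muleDr//; apply: leeD2l.
rewrite [in leRHS]EFinM -[leRHS]muleA; exact: lee_wpmul2l.
Qed.

(** The order of the choices matters.  The overlap bound N is independent of the
    radius, so the Poincare parameter e1 can be fixed first, making the
    contribution of the oscillations at most e / 2 for every small r.  Then r determines the balls,
    and only then is the tolerance d for the averages chosen, according to the
    total weight V of these balls. *)
Lemma poincare_ultrafilter_cauchy (K : set E) (M e : R) (f : nat -> E -> R)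
    (U : set_system nat) :
  loc_geom_doubling Omega rho -> loc_poincare Omega rho mu Q v p ->
  compact K -> K `<=` Omega -> 0 <= M -> UltraFilter U -> 0 < e ->
  (forall j, loc_lipschitz Omega (f j)) ->
  (forall j, (wp p Omega (f j) <= M%:E)%E) ->
  (forall j, (gp Omega (grad (f j)) <= M%:E)%E) ->
  exists2 A, U A & forall i j, A i -> A j -> (wp p K (f i \- f j)%R <= e%:E)%E.
Proof.
move=> dbl [c0 c01 HP] cK KO M0 UU e0 fl fM gM.
have [N N0 HN] := bounded_overlap_cover rho_qm rho_balls c01 dbl cK KO.
have [d0 d00 Hd0] := small_ball_weight_lty Obounded v0 v_loc rho_qm rho_balls cK KO.
have mf j := loc_lipschitz_measurable openG Oopen (fl j).
have e20 : 0 < e / 2 by rewrite divr_gt0.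
pose t2 : R := 2 `^ p.
have t20 : 0 <= t2 by exact: powR_ge0.
have K10 : 0 <= (t2 + t2 * t2) * (t2 * (N * M + N * M)).
  by rewrite !(mulr_ge0, addr_ge0)// ltW.
have [e1 e10 He1] := small_powR p0 K10 e20.
have [d1 d10 HPd] := HP K e1 cK KO e10.
have [|r [s [/andP[r0 rd] sK Ks sN]]] := HN (Num.min d0 d1).
  by rewrite lt_min d00.
have [rd0 rd1] : r < d0 /\ r < d1 by move: rd; rewrite lt_min => /andP.
have BO := @ball_sub; have mB x r' : Omega x -> measurable (B x r' : set T).
  by move=> Ox; apply: open_measurable_G => //; exact: rho_balls.1.
have sO x : x \in s -> Omega x by move=> /sK/KO.
pose S0 := (e1 `^ p * t2) * (N * M + N * M).
have S j : (\sum_(x <- s) wp p (B x r) (fun y => f j y - wmean mu v (B x r) (f j))%R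
    <= S0%:E)%E.
  have wB x r' : (wp p (B x r') (f j) < +oo)%E.
    apply: le_lt_trans (wpow_subset mu p (f j) (@BO x r') v0) _.
    by apply: le_lt_trans (fM j) _; rewrite ltry.
  have gB x r' : (gp (B x r') (grad (f j)) < +oo)%E.
    apply: (@le_lt_trans _ _ (gp Omega (grad (f j)))).
      apply: ge0_subset_lower_integral; first exact: BO.
      by move=> y _; rewrite lee_fin powR_ge0.
    by apply: le_lt_trans (gM j) _; rewrite ltry.
  apply: (@le_trans _ _ (\sum_(x <- s) (e1 `^ p * t2)%:E *
      (wp p (B x (c0 * r)) (f j) + gp (B x (c0 * r)) (grad (f j))))%E).
    rewrite big_seq [leRHS]big_seq; apply: lee_sum => x xs.
    apply: (ball_poincare p1 v0 (@BO x r) (@BO x (c0 * r)) (ltW e10) (wB _ _) (gB _ _)).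
    by apply: HPd => //; [rewrite r0|exact: sK].
  have w0 x : (0 <= wp p (B x (c0 * r)) (f j))%E.
    by apply: wpow_ge0 => y /BO; exact: v0.
  have g0 x : (0 <= gp (B x (c0 * r)) (grad (f j)))%E by exact: gpow_ge0.
  rewrite -ge0_sume_distrr; last by move=> x _; rewrite adde_ge0.
  rewrite /S0 (EFinM (e1 `^ p * t2)); apply: lee_wpmul2l.
    by rewrite lee_fin mulr_ge0 ?powR_ge0.
  rewrite big_split/= (EFinD (N * M)) (EFinM N M).
  have N0e : (0 <= N%:E)%E by rewrite lee_fin ltW.
  have mB' x : x \in s -> measurable (B x (c0 * r) : set T).
    by move=> /sO; exact: mB.
  have BO' x : x \in s -> B x (c0 * r) `<=` Omega by move=> _; exact: BO.
  apply: leeD; apply: le_trans (lee_wpmul2l N0e _).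
  - apply: (sum_lower_integral_overlap mu mO N0 mB' BO' _ sN) => x Ox.
    by rewrite mulr_ge0 ?powR_ge0 ?v0.
  - exact: fM.
  - apply: (sum_lower_integral_overlap mu mO N0 mB' BO' _ sN) => x Ox.
    exact: powR_ge0.
  - exact: gM.
pose vB x := fine (\int[mu]_(y in (B x r : set T)) (v y)%:E)%E.
have vB0 x : (0 <= \int[mu]_(y in (B x r : set T)) (v y)%:E)%E.
  by apply: integral_ge0 => y /BO Oy; rewrite lee_fin v0.
have vBE x : x \in s -> (\int[mu]_(y in (B x r : set T)) (v y)%:E = (vB x)%:E)%E.
  move=> xs; rewrite fineK// ge0_fin_numE//; apply: Hd0 => //; exact: sK.
pose V := \sum_(x <- s) vB x.
have V0 : 0 <= V by apply: sumr_ge0 => x _; exact: fine_ge0.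
have TV0 : 0 <= t2 * t2 * V by rewrite !mulr_ge0.
have [d d_gt0 Hd] := small_powR p0 TV0 e20.
have [x xs|//|A UA HA] := @ultrafilter_near_constant_seq R _ s U
    (fun x j => wmean mu v (B x r) (f j)) d UU.
  have [M' HM'] := wmean_bounded openG Oopen p1 v0 v_loc (mB x r (sO _ xs)) (@BO x r)
    (Hd0 _ _ (sK _ xs) rd0) M0.
  exists M' => j; apply: HM'; first exact: mf.
  exact: le_trans (wpow_subset mu p (f j) (@BO x r) v0) (fM j).
exists A => // i j Ai Aj.
have mfij : measurable_fun (Omega : set T) ((f i \- f j) : T -> R).
  exact: measurable_funB.
apply: (le_trans (wpow_cover mu p mO mv v0 mfij (B := fun x => B x r) _ _ Ks)).
- by move=> x /sO; exact: mB.
- by move=> x _; exact: BO.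
apply: (@le_trans _ _ (\sum_(x <- s)
    (t2%:E * wp p (B x r) (fun y => f i y - wmean mu v (B x r) (f i))%R +
     ((t2 * t2)%:E * wp p (B x r) (fun y => f j y - wmean mu v (B x r) (f j))%R +
     (t2 * t2 * d `^ p)%:E * (vB x)%:E)))%E).
  rewrite big_seq [leRHS]big_seq; apply: lee_sum => x xs; rewrite -vBE//.
  have mBx := mB x r (sO _ xs).
  have mfB k := measurable_funS mO (@BO x r) (mf k).
  exact: (wpow_split_mean mBx (@BO x r) (mfB i) (mfB j) (HA x xs i j Ai Aj)).
have w0 k x : (0 <= wp p (B x r) k)%E by apply: wpow_ge0 => y /BO; exact: v0.
apply: le_trans (@sume_linear3_le R _ s _ _ (fun x => (vB x)%:E) t2 (t2 * t2)
  (t2 * t2 * d `^ p) S0 S0 V _ _ _ _ _ _ (S i) (S j) _) _ => //.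
- exact: mulr_ge0.
- by rewrite mulr_ge0 ?powR_ge0// mulr_ge0.
- by move=> x; rewrite lee_fin; exact: fine_ge0.
- by rewrite sumEFin.
rewrite lee_fin.
have -> : t2 * S0 + (t2 * t2 * S0 + t2 * t2 * d `^ p * V) =
  (t2 + t2 * t2) * (t2 * (N * M + N * M)) * e1 `^ p + t2 * t2 * V * d `^ p.
  by rewrite /S0; ring.
by rewrite [leRHS]splitr lerD.
Qed.

End PoincareCauchy.

(** * Passage to the completed Sobolev space *)

Section SobolevSpaceBounds.
Context {R : realType} {n : nat}.
Let E := 'rV[R]_n.
Context {G : set (set E)}.
Let T := g_sigma_algebraType G.
Hypothesis openG : forall U : set E, open U -> <<s G >> U.
Variables (Omega : set E) (mu : {measure set T -> \bar R}).
Hypothesis Oopen : open Omega.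
Variables (Q : E -> 'M[R]_n) (v : E -> R) (p : R).
Hypothesis p0 : 0 < p.
Hypothesis v0 : forall x, Omega x -> 0 <= v x.
Hypothesis mv : measurable_fun (Omega : set T) (v : T -> R).
Hypothesis sqrtQmeas : measurable_mx_fun G Omega (fun x => sqrtmx (Q x)).
Local Notation wp := (wpow mu v).
Local Notation gp := (gpow mu Q p).

Let mO : measurable (Omega : set T).
Proof. exact: open_measurable_G. Qed.

Lemma measurable_enorm_sqrtmx (k : E -> 'cV[R]_n) : measurable_mx_fun G Omega k ->
  measurable_fun (Omega : set T) ((fun x => enorm (sqrtmx (Q x) *m k x) `^ p) : T -> R).
Proof.
move=> mk; apply: (measurableT_comp (measurable_powR p)).
apply: (measurableT_comp (continuous_measurable_fun (@sqrt_continuous R))).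
apply: measurable_sum => i; apply: measurable_funX.
under eq_fun do rewrite mxE.
by apply: measurable_sum => j; apply: measurable_funM.
Qed.

(** Split grad f = (grad f - k) + k: the field k is measurable, as
    lower_integral_le_lin requires of one of the summands. *)
Lemma lip_energy_le (f u : E -> R) (k : E -> 'cV[R]_n) (M : R) : 0 <= M ->
  loc_lipschitz Omega f -> measurable_fun (Omega : set T) (u : T -> R) ->
  measurable_mx_fun G Omega k ->
  (QHnorm mu Q v p Omega u k <= M%:E)%E ->
  (QHnorm mu Q v p Omega (f \- u)%R (grad f \- k)%R <= 1%:E)%E ->
  (wp p Omega f <= (2 `^ p * 2 `^ p * (1 + M `^ p))%:E)%E /\
  (gp Omega (grad f) <= (2 `^ p * 2 `^ p * (1 + M `^ p))%:E)%E.
Proof.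
move=> M0 fl mu_ mk uM fu.
have mf := loc_lipschitz_measurable openG Oopen fl.
have [uM1 uM2] := QHnorm_le p0 v0 (@subset_refl _ Omega) M0 uM.
have [fu1 fu2] := QHnorm_le p0 v0 (@subset_refl _ Omega) ler01 fu.
rewrite powR1 in fu1 fu2.
have t1 : 1 <= 2 `^ p :> R.
  have : 1 `^ p <= 2 `^ p :> R by apply: ler_powR2r; rewrite ?ler1n ?(ltW p0).
  by rewrite powR1.
have t0 : 0 <= 2 `^ p :> R by exact: le_trans t1.
have tt0 : 0 <= 2 `^ p * 2 `^ p :> R by exact: mulr_ge0.
have M1 : 0 <= 1 + M `^ p by rewrite addr_ge0 ?powR_ge0.
split.
  apply: le_trans (wpow_le_add mu mO mv v0 (f := f) p0 (measurable_funB mf mu_) mu_ _) _.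
    by move=> x _; rewrite -[X in `|X|](subrK (u x)); exact: ler_normD.
  apply: (@le_trans _ _ ((2 `^ p)%:E * (1%:E + (M `^ p)%:E))%E).
    by apply: lee_wpmul2l; [rewrite lee_fin|exact: leeD].
  rewrite -EFinD -EFinM lee_fin -mulrA ler_wpM2l// ler_peMl//.
apply: (@le_trans _ _ ((2 `^ p * 2 `^ p)%:E * gp Omega (grad f \- k)%R +
   \int[mu]_(x in (Omega : set T))
     (2 `^ p * 2 `^ p * enorm (sqrtmx (Q x) *m k x) `^ p)%:E)%E).
  apply: lower_integral_le_lin => //.
  - by move=> x _; exact: powR_ge0.
  - by move=> x _; exact: powR_ge0.
  - by move=> x _; rewrite mulr_ge0 ?powR_ge0.
  - by apply: measurable_funM => //; exact: measurable_enorm_sqrtmx.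
  move=> x _; rewrite -mulrDr -mulrA.
  have -> : sqrtmx (Q x) *m grad f x =
      sqrtmx (Q x) *m (grad f \- k) x + sqrtmx (Q x) *m k x.
    by rewrite -mulmxDr /= subrK.
  set a := _ *m _; set b := _ *m k x.
  apply: (@le_trans _ _ ((2 * (enorm a + enorm b)) `^ p)).
    by apply: ler_powR2r; rewrite ?enorm_ge0 ?enormD_le// ltW.
  rewrite powRM ?addr_ge0 ?enorm_ge0// ler_wpM2l//.
  exact: powRD_le p0 (enorm_ge0 _) (enorm_ge0 _).
under [X in (_ + X <= _)%E]eq_integral do rewrite EFinM.
rewrite ge0_integralZl_EFin//; last 2 first.
- by move=> x _; rewrite lee_fin powR_ge0.
- by apply/measurable_EFinP; exact: measurable_enorm_sqrtmx.
rewrite mulrDr EFinD mulr1 (EFinM (2 `^ p * 2 `^ p)).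
apply: leeD; last by apply: lee_wpmul2l; rewrite ?lee_fin.
rewrite -[leRHS]mule1; apply: lee_wpmul2l; by rewrite ?lee_fin.
Qed.

Lemma QHspace_approx (u : E -> R) (k : E -> 'cV[R]_n) (e : R) :
  QHspace Omega mu Q v p u k -> 0 < e ->
  exists2 f : E -> R, loc_lipschitz Omega f &
    (QHnorm mu Q v p Omega (f \- u)%R (grad f \- k)%R <= e%:E)%E.
Proof.
move=> [_ _ [f [fl]]] /fine_cvgP[ffin /cvgrPdist_le fc] e0.
have [j [fj ej]] := filter_ex (filterI ffin (fc e e0)).
exists (f j); first by case: (fl j).
move: ej; rewrite sub0r normrN -lee_fin => /(le_trans _); apply.
by rewrite -[leLHS](fineK fj) lee_fin ler_norm.
Qed.

End SobolevSpaceBounds.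

Section CompactEmbedding.
Context {R : realType} {n : nat}.
Let Rn := 'rV[R]_n.
Context {G : set (set Rn)}.
Let T := g_sigma_algebraType G.
Hypothesis openG : forall U : set Rn, open U -> <<s G >> U.
Variables (Omega : set Rn) (mu : {measure set T -> \bar R}).
Hypotheses (Obounded : bounded_set Omega) (Oopen : open Omega).
Variables (p : R) (Q : Rn -> 'M[R]_n) (v : Rn -> R) (rho : Rn -> Rn -> R) (sigma : R).
Hypothesis p1 : 1 <= p.
Hypothesis sqrtQmeas : measurable_mx_fun G Omega (fun x => sqrtmx (Q x)).
Hypothesis v_ge0 : forall x, Omega x -> 0 <= v x.
Hypothesis v_loc : locally_integrable_on Omega mu v.
Hypothesis v0_le : exists2 c2 : R, 0 < c2 &
  forall x, Omega x -> opnorm (Q x) `^ (p / 2) <= c2 * v x.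
Hypothesis rho_qm : quasimetric Omega rho.
Hypothesis rho_balls : qball_conditions Omega rho.
Hypothesis sobolev : loc_sobolev Omega rho mu Q v p sigma.
Hypothesis sigma1 : 1 < sigma.
Variable E : set Rn.
Hypothesis mE : measurable (E : set T).
Hypothesis E_Omega : relcompact_in E Omega.
Local Notation wp := (wpow mu v).
Local Notation gp := (gpow mu Q p).
Local Notation QH := (QHspace Omega mu Q v p).

Let p0 : 0 < p := lt_le_trans ltr01 p1.
Let s0 : 0 < sigma := lt_trans ltr01 sigma1.
Let r0 : 0 < p * sigma := mulr_gt0 p0 s0.
Let mv : measurable_fun (Omega : set T) (v : T -> R) := v_loc.1.
Let mO : measurable (Omega : set T).
Proof. exact: open_measurable_G. Qed.
Let EO : E `<=` Omega := subset_trans (@subset_closure _ E) E_Omega.2.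
Let vE0 x : E x -> 0 <= v x.
Proof. by move=> /EO; exact: v_ge0. Qed.
Let mvE : measurable_fun (E : set T) (v : T -> R) := measurable_funS mO EO mv.

Lemma weight_E_lty : (\int[mu]_(x in (E : set T)) (v x)%:E < +oo)%E.
Proof.
have [cK KO] := E_Omega.
apply: le_lt_trans (weight_compact_lty v_ge0 v_loc cK KO).
apply: ge0_subset_lower_integral; first exact: subset_closure.
by move=> x /KO Ox; rewrite lee_fin v_ge0.
Qed.

Lemma QHspace_meas u k : QH u k ->
  measurable_fun (Omega : set T) (u : T -> R) /\ measurable_mx_fun G Omega k.
Proof. by move=> [[mu_ _] [mk _] _]. Qed.

(** Lipschitz functions converging to u at a dyadic rate converge almost
    everywhere, and Fatou's lemma passes their Sobolev bound on to u. *)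
Lemma QH_higher_integrability (M : R) : 0 <= M -> exists2 M' : R, 0 <= M' &
  forall u k, QH u k -> (QHnorm mu Q v p Omega u k <= M%:E)%E ->
    (wp (p * sigma) E u <= M'%:E)%E.
Proof.
move=> M0; have [cK KO] := E_Omega.
pose M2 : R := 2 `^ p * 2 `^ p * (1 + M `^ p).
have M20 : 0 <= M2 by rewrite !mulr_ge0 ?powR_ge0// addr_ge0// powR_ge0.
have [M' M'0 HM'] := sobolev_on_compact openG Obounded Oopen p0 v_ge0 mv v0_le
  rho_qm rho_balls sobolev s0 M20 cK KO.
exists M' => // u k uk uM; have [mu_ mk] := QHspace_meas uk.
(* e j ^ p is the rate required by ae_cvg_of_dyadic_dist *)
pose e j : R := (dyad j * dyad j `^ p) `^ p^-1.
have e0 j : 0 < e j by rewrite powR_gt0//; have [] := dyad_rate j p0.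
have e1 j : e j <= 1.
  have [d0 d1] := @dyad_rate R p j p0.
  by apply: powR_le1; rewrite ?invr_ge0 ?(ltW p0) ?(ltW d0)// (le_trans d1)// dyad_le1.
have eE j : e j `^ p = dyad j * dyad j `^ p.
  rewrite /e -powRrM mulVf ?gt_eqF// powRr1//; apply: ltW.
  by have [] := @dyad_rate R p j p0.
have /choice[f Hf] j : exists f, loc_lipschitz Omega f /\
    (QHnorm mu Q v p Omega (f \- u)%R (grad f \- k)%R <= (e j)%:E)%E.
  by have [f fl fe] := QHspace_approx uk (e0 j); exists f.
have mf j : measurable_fun (Omega : set T) (f j : T -> R).
  by apply: loc_lipschitz_measurable => //; case: (Hf j).
have fu j : (wp p Omega (f j \- u)%R <= (dyad j * dyad j `^ p)%:E)%E.
  have [_ H] := Hf j; rewrite -eE.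
  exact: (QHnorm_le p0 v_ge0 (@subset_refl _ Omega) (ltW (e0 j)) H).1.
have fM j : (wp (p * sigma) E (f j) <= M'%:E)%E.
  have [fl H] := Hf j.
  have H1 : (QHnorm mu Q v p Omega (f j \- u)%R (grad (f j) \- k)%R <= 1%:E)%E.
    by apply: le_trans H _; rewrite lee_fin.
  have [fA gA] := lip_energy_le openG Oopen p0 v_ge0 mv sqrtQmeas M0 fl mu_ mk uM H1.
  apply: le_trans (HM' _ fl fA gA); apply: wpow_subset; first exact: subset_closure.
  by move=> x /KO; exact: v_ge0.
have fuE j : (wp p E (f j \- u)%R <= (dyad j * dyad j `^ p)%:E)%E.
  exact: le_trans (wpow_subset mu p (f j \- u)%R EO v_ge0) (fu j).
have mfE j := measurable_funS mO EO (mf j); have muE := measurable_funS mO EO mu_.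
exact: (wpow_fatou mE mvE vE0 r0 muE mfE
  (ae_cvg_of_dyadic_dist mE mvE vE0 p0 muE mfE fuE) fM).
Qed.

(** Each u_j is replaced by a Lipschitz function f_j with an error tending to 0
    in L^p_v.  The indices with a small error form a member of the ultrafilter,
    since it contains all cofinite sets. *)
Lemma QH_cauchy_subsequence (u : nat -> Rn -> R) (k : nat -> Rn -> 'cV[R]_n) (M : R) :
  loc_geom_doubling Omega rho -> loc_poincare Omega rho mu Q v p -> 0 <= M ->
  (forall j, QH (u j) (k j)) ->
  (forall j, (QHnorm mu Q v p Omega (u j) (k j) <= M%:E)%E) ->
  exists2 phi : nat -> nat, {homo phi : i j / (i < j)%N} &
    forall l i j, (l <= i)%N -> (l <= j)%N ->
      (wp p E (u (phi i) \- u (phi j))%R <= (dyad l * dyad l `^ p)%:E)%E.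
Proof.
move=> dbl poi M0 uk uM; have [cK KO] := E_Omega.
have [U [UU oU]] := free_ultrafilter.
apply: (@ultrafilter_extraction U (fun l i j =>
  (wp p E (u i \- u j)%R <= (dyad l * dyad l `^ p)%:E)%E)) => // l.
set th := dyad l * _; have th0 : 0 < th by have [] := @dyad_rate R p l p0.
pose M2 : R := 2 `^ p * 2 `^ p * (1 + M `^ p).
have M20 : 0 <= M2 by rewrite !mulr_ge0 ?powR_ge0// addr_ge0// powR_ge0.
pose e j : R := (dyad j) `^ p^-1.
have e0 j : 0 < e j by rewrite powR_gt0// dyad_gt0.
have e1 j : e j <= 1.
  by apply: powR_le1; rewrite ?invr_ge0 ?(ltW p0) ?(ltW (dyad_gt0 j)) ?dyad_le1.
have eE j : e j `^ p = dyad j.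
  by rewrite /e -powRrM mulVf ?gt_eqF// powRr1// ltW// dyad_gt0.
have /choice[f Hf] j : exists f, loc_lipschitz Omega f /\
    (QHnorm mu Q v p Omega (f \- u j)%R (grad f \- k j)%R <= (e j)%:E)%E.
  by have [f fl fe] := QHspace_approx (uk j) (e0 j); exists f.
have fl j : loc_lipschitz Omega (f j) by case: (Hf j).
have mu_ j := (QHspace_meas (uk j)).1.
have mf j : measurable_fun (Omega : set T) (f j : T -> R).
  exact: loc_lipschitz_measurable.
have fu j : (wp p E (f j \- u j)%R <= (dyad j)%:E)%E.
  have [_ H] := Hf j; rewrite -eE.
  apply: le_trans (wpow_subset mu p (f j \- u j)%R EO v_ge0) _.
  exact: (QHnorm_le p0 v_ge0 (@subset_refl _ Omega) (ltW (e0 j)) H).1.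
have fA j : (wp p Omega (f j) <= M2%:E)%E /\ (gp Omega (grad (f j)) <= M2%:E)%E.
  have [_ H] := Hf j.
  apply: (lip_energy_le openG Oopen p0 v_ge0 mv sqrtQmeas M0 (fl j) (mu_ j)
    (QHspace_meas (uk j)).2 (uM j)).
  by apply: le_trans H _; rewrite lee_fin.
pose t2 : R := 2 `^ p.
have t20 : 0 < t2 by rewrite powR_gt0.
pose c := th / (3 * (t2 * t2)).
have c0 : 0 < c by rewrite divr_gt0// !mulr_gt0.
have [A UA HA] := poincare_ultrafilter_cauchy openG Obounded Oopen p1 v_ge0 v_loc
  rho_qm rho_balls dbl poi cK KO M20 UU c0 fl (fun j => (fA j).1) (fun j => (fA j).2).
have Uc : U [set j | dyad j <= c].
  apply: oU; have /cvgrPdist_le/(_ _ c0) := @cvg_dyad0 R 1.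
  apply: filterS => j /=; rewrite mul1r sub0r normrN => /(le_trans _); apply.
  exact: ler_norm.
exists (A `&` [set j | dyad j <= c]); first exact: filterI.
move=> i j [Ai /= ic] [Aj /= jc].
have mfE m := measurable_funS mO EO (mf m).
have muE m := measurable_funS mO EO (mu_ m).
have H1 : (wp p E (u i \- u j)%R <= t2%:E * (wp p E (f i \- u i)%R +
    wp p E (fun x => `|f i x - f j x| + `|f j x - u j x|)%R))%E.
  apply: wpow_le_add => //.
  - exact: measurable_funB.
  - apply: measurable_funD; apply: measurableT_comp => //; exact: measurable_funB.
  move=> x _.
  have -> : (u i \- u j) x = - (f i x - u i x) + ((f i x - f j x) + (f j x - u j x)).
    by rewrite /=; ring.
  apply: le_trans (ler_normD _ _) _; rewrite normrN lerD2l.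
  rewrite [leRHS]ger0_norm ?addr_ge0//; exact: ler_normD.
have H2 : (wp p E (fun x => `|f i x - f j x| + `|f j x - u j x|)%R <=
    t2%:E * (wp p E (f i \- f j)%R + wp p E (f j \- u j)%R))%E.
  apply: wpow_le_add => //; [exact: measurable_funB|exact: measurable_funB|].
  by move=> x _; rewrite ger0_norm ?addr_ge0.
have H3 : (wp p E (f i \- f j)%R <= c%:E)%E.
  apply: le_trans (HA i j Ai Aj); apply: wpow_subset; first exact: subset_closure.
  by move=> x /KO; exact: v_ge0.
have H4 m : dyad m <= c -> (wp p E (f m \- u m)%R <= c%:E)%E.
  by move=> mc; apply: le_trans (fu m) _; rewrite lee_fin.
apply: le_trans (le_nested3 (ltW t20) H1 H2 (H4 i ic) H3 (H4 j jc)) _.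
rewrite lee_fin.
have t21 : 1 <= t2.
  have : 1 `^ p <= 2 `^ p :> R by apply: ler_powR2r; rewrite ?ler1n ?(ltW p0).
  by rewrite powR1.
have -> : th = 3 * (t2 * t2) * c.
  by rewrite /c mulrC divfK// gt_eqF// !mulr_gt0.
have tc : t2 * c <= t2 * t2 * c by rewrite -mulrA ler_peMl// mulr_ge0// ltW.
have -> : t2 * (c + t2 * (c + c)) = t2 * c + 2 * (t2 * t2 * c) by ring.
have -> : 3 * (t2 * t2) * c = t2 * t2 * c + 2 * (t2 * t2 * c) by ring.
by rewrite lerD2r.
Qed.

End CompactEmbedding.

Unset Implicit Arguments.

(** * The compact embedding *)

Theorem theorem1p4 (R : realType) (n : nat) (hn : (0 < n)%N)
  (Omega : set 'rV[R]_n)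
  (Obounded : bounded_set Omega) (Oopen : open Omega) (Oconn : connected Omega)
  (G : set (set 'rV[R]_n))
  (openG : forall U : set 'rV[R]_n, open U -> <<s G >> U)
  (mu : {measure set (g_sigma_algebraType G) -> \bar R})
  (mu_reg : regular_on Omega mu) (mu_ac : abs_cont_lebesgue Omega mu)
  (p : R) (hp : 1 < p)
  (Q : 'rV[R]_n -> 'M[R]_n)
  (Qmeas : measurable_mx_fun G Omega Q)
  (Qpsd : forall x, Omega x -> psdmx (Q x))
  (sqrtQmeas : measurable_mx_fun G Omega (fun x => sqrtmx (Q x)))
  (sqrtQ_Lp :
    (\int[mu]_(x in Omega) (opnorm (sqrtmx (Q x)) `^ p)%:E < +oo)%E)
  (v : 'rV[R]_n -> R)
  (v_ge0 : forall x, Omega x -> 0 <= v x)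
  (v_loc : locally_integrable_on Omega mu v)
  (v0_le : exists2 c2 : R, 0 < c2 &
    forall x, Omega x -> opnorm (Q x) `^ (p / 2) <= c2 * v x)
  (rho : 'rV[R]_n -> 'rV[R]_n -> R)
  (rho_qm : quasimetric Omega rho)
  (rho_balls : qball_conditions Omega rho)
  (rho_doubling : loc_geom_doubling Omega rho)
  (poincare : loc_poincare Omega rho mu Q v p)
  (sigma : R) (hsigma : 1 < sigma)
  (sobolev : loc_sobolev Omega rho mu Q v p sigma)
  (E : set 'rV[R]_n) (Emeas : <<s G >> E) (E_Omega : relcompact_in E Omega)
  (q : R) (hq : 1 <= q < p * sigma) :
  (forall (u : 'rV[R]_n -> R) (k : 'rV[R]_n -> 'cV[R]_n),
     QHspace Omega mu Q v p u k -> in_Lqv mu v q E u) /\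
  (forall (u : nat -> 'rV[R]_n -> R) (k : nat -> 'rV[R]_n -> 'cV[R]_n) (M : R),
     (forall j, QHspace Omega mu Q v p (u j) (k j)) ->
     (forall j, (QHnorm mu Q v p Omega (u j) (k j) <= M%:E)%E) ->
     exists (phi : nat -> nat) (g : 'rV[R]_n -> R),
       [/\ {homo phi : i j / (i < j)%N}, in_Lqv mu v q E g &
           (fun j => wLnorm mu v q E (u (phi j) \- g)) @ \oo --> 0%E]).
Proof.
have p1 : 1 <= p by exact: ltW.
have p0 : 0 < p by exact: lt_le_trans p1.
have /andP[q1 qr] := hq.
have q0 : 0 < q by exact: lt_le_trans q1.
have pr : 0 < p < p * sigma by rewrite p0 ltr_pMr.
have qqr : 0 < q < p * sigma by rewrite q0.
have mE : measurable (E : set (g_sigma_algebraType G)) := Emeas.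
have mO : measurable (Omega : set (g_sigma_algebraType G)).
  exact: open_measurable_G.
have EO : E `<=` Omega := subset_trans (@subset_closure _ E) E_Omega.2.
have vE0 x : E x -> 0 <= v x by move=> /EO; exact: v_ge0.
have mvE := measurable_funS mO EO v_loc.1.
have vE := weight_E_lty v_ge0 v_loc E_Omega.
have higher := QH_higher_integrability openG Obounded Oopen p1 sqrtQmeas v_ge0 v_loc
  v0_le rho_qm rho_balls sobolev hsigma mE E_Omega.
split.
  move=> u k uk; have [mu_ mk] := QHspace_meas uk.
  have QHfin : (QHnorm mu Q v p Omega u k < +oo)%E.
    by case: uk => [[_ H1] [_ H2] _]; exact: lte_add_pinfty.
  have QH0 : (0 <= QHnorm mu Q v p Omega u k)%E.
    by apply: adde_ge0; exact: poweR_ge0.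
  have QHE : QHnorm mu Q v p Omega u k = (fine (QHnorm mu Q v p Omega u k))%:E.
    by rewrite fineK// ge0_fin_numE.
  have [M' M'0 HM'] := higher _ (fine_ge0 QH0).
  have muE := measurable_funS mO EO mu_.
  split => //; apply: poweR_lty.
  apply: (wpow_lty_of_higher mE mvE vE0 vE qqr muE).
  by apply: le_lt_trans (HM' u k uk _) (ltry _); rewrite -QHE.
move=> u k M uk uM.
have M0 : 0 <= M.
  rewrite -lee_fin; apply: le_trans (uM 0%N).
  by apply: adde_ge0; exact: poweR_ge0.
have [M' M'0 HM'] := higher _ M0.
have [phi phi_inc phiC] := QH_cauchy_subsequence openG Obounded Oopen p1 sqrtQmeas
  v_ge0 v_loc rho_qm rho_balls mE E_Omega rho_doubling poincare M0 uk uM.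
have muE j := measurable_funS mO EO (QHspace_meas (uk j)).1.
have [g [mg gq ug]] := wpow_complete mE mvE vE0 vE pr qqr (fun j => muE (phi j))
  (fun j => HM' _ _ (uk (phi j)) (uM (phi j))) phiC.
exists phi, g; split => //; first by split => //; exact: poweR_lty.
have small (e : R) : 0 < e ->
    \forall j \near \oo, (wLnorm mu v q E (u (phi j) \- g)%R <= e%:E)%E.
  move=> e0; have := ug (e `^ q) (powR_gt0 _ e0); apply: filterS => j H.
  by apply/poweR_inv_le => //; [exact: wpow_ge0|exact: ltW].
apply/fine_cvgP; split.
  apply: filterS (small 1 ltr01) => j H.
  rewrite ge0_fin_numE; last exact: poweR_ge0.
  by apply: le_lt_trans H _; rewrite ltry.
apply/cvgrPdist_le => e e0; apply: filterS (small e e0) => j H.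
have w0 : (0 <= wLnorm mu v q E (u (phi j) \- g)%R)%E by exact: poweR_ge0.
rewrite sub0r normrN /= ger0_norm; last exact: fine_ge0.
rewrite -lee_fin fineK// ge0_fin_numE//.
by apply: le_lt_trans H _; rewrite ltry.
Qed.
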